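(* Let $A$ be a finite arrangement of real hyperplanes in $\mathbb{C}^n$ with defining functions $f_h(z)=u_{h,0}+\sum_{i=1}^n u_{h,i}z_i$, $u_h=(u_{h,1},\dots,u_{h,n})\ne0$ ($h\in A$), let $\lambda_h>0$ for $h\in A$, and let $P(z)=\sum_{h\in A}\lambda_h\log f_h(z)$. Let $Q_t(z)=\sum_{m=0}^{+\infty}t^mQ^{[m]}(z)$ be the power series solution in $t$ of $$\frac{\partial Q_t}{\partial t}=\frac12\langle\nabla Q_t,\nabla Q_t\rangle,\qquad Q_{t=0}=P,$$ so $Q^{[0]}=P$. Then: (1) For every $m\ge 1$, $$m\,Q^{[m]}(z)=\frac12\sum_{i+j=m-1}\langle\nabla Q^{[i]},\nabla Q^{[j]}\rangle(z)\qquad(i,j\ge0).$$ (2) For every $m\ge1$, $Q^{[m]}$ is a sum over trees: there are numerical constants $c_T$, one for each isomorphism class of (non-labeled) trees $T$ with $m+1$ vertices (and hence $m$ edges), depending only on $T$, such that $$Q^{[m]}=\sum_T c_T\,W_T .$$ (3) For $1\le m\le 5$ these expansions are: $Q^{[1]}=\frac12W_{P_2}$; $Q^{[2]}=-\frac12W_{P_3}$; $Q^{[3]}=\frac13W_{S(1,1,1)}+\frac12W_{P_4}$; $Q^{[4]}=-\frac12W_{P_5}-W_{S(2,1,1)}-\frac14W_{S(1,1,1,1)}$; $Q^{[5]}=\frac12W_{P_6}+W_{S(3,1,1)}+W_{S(2,2,1)}+\frac12W_{D}+W_{S(2,1,1,1)}+\frac15W_{S(1,1,1,1,1)}$. In particular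 $Q^{[1]}(z)=\frac12\sum_{(h,k)\in A^2}\frac{\lambda_h\lambda_k\langle u_h,u_k\rangle}{f_h(z)f_k(z)}$ and $Q^{[2]}(z)=-\frac12\sum_{(h,k,l)\in A^3}\frac{\lambda_h\lambda_k\lambda_l\langle u_h,u_k\rangle\langle u_h,u_l\rangle}{f_k(z)f_h(z)^2f_l(z)}$.
   Context: All coefficients $u_{h,i}$ are real. $\nabla$ is the gradient in $z$ and $\langle a,b\rangle=\sum_{i=1}^n a_ib_i$. Everything is considered off the hyperplanes, with local branches of the logarithms fixed ($\nabla P=\sum_h\lambda_hu_h/f_h$ is single-valued). For a tree $T$ with vertex set $\{1,\dots,m+1\}$ and edge set $E(T)$, its weight is $$W_T(z)=\sum_{(h_1,\dots,h_{m+1})\in A^{m+1}}\ \prod_{v=1}^{m+1}\lambda_{h_v}\ \prod_{\{v,w\}\in E(T)}\frac{\langle u_{h_v},u_{h_w}\rangle}{f_{h_v}(z)f_{h_w}(z)},$$ which depends only on the isomorphism class of $T$. Trees used: $P_r$ is the path with $r$ vertices; $S(l_1,\dots,l_d)$ is the spider consisting of a central vertex to which are attached $d$ disjoint paths (legs) with $l_1,\dots,l_d$ edges (so $S(1,\dots,1)$ with $d$ ones is the star with $d$ leaves); $D$ is the tree with 6 vertices consisting of two adjacent vertices, each of which is adjacent to two further leaves. *)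

(* Defs.v *)
(* MathComp / MathComp-Analysis *)
From HB Require Import structures.
From mathcomp Require Import all_boot all_order all_algebra all_fingroup.
From mathcomp Require Import complex.
From mathcomp Require Import all_classical all_reals all_analysis.

Set Implicit Arguments.
Unset Strict Implicit.
Unset Printing Implicit Defensive.

Import Order.TTheory GRing.Theory Num.Theory.
Import numFieldNormedType.Exports.

Local Open Scope classical_set_scope.
Local Open Scope ring_scope.
Local Open Scope complex_scope.

(* Bundling R[i] as a numClosedFieldType gives it (and its row vectors) the
   norm topology that MathComp-Analysis attaches to every numFieldType. *)
Definition cplx (R : realType) : numClosedFieldType := R[i].

Definition of_real (R : realType) (x : R) : cplx R := x%:C.

Definition cexp (R : realType) (w : cplx R) : cplx R :=
  (expR (complex.Re w) * cos (complex.Im w)) +i*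
  (expR (complex.Re w) * sin (complex.Im w)).

(* Bilinear: no complex conjugation. *)
Definition dotp (K : comNzRingType) (n : nat) (a b : 'rV[K]_n) : K :=
  \sum_(i < n) a 0 i * b 0 i.

Definition grad (K : numFieldType) (n : nat) (q : 'rV[K]_n -> K)
    (z : 'rV[K]_n) : 'rV[K]_n :=
  \row_(i < n) 'D_(delta_mx 0 i) q z.

(* A formal power series in t is the sequence of its coefficients. *)
Definition fps_deriv (K : comNzRingType) (a : nat -> K) : nat -> K :=
  fun k => k.+1%:R * a k.+1.

Definition fps_mul (K : comNzRingType) (a b : nat -> K) : nat -> K :=
  fun k => \sum_(i < k.+1) a i * b (k - i)%N.

(* Q m is the coefficient of t^m.  The equation
   dQ_t/dt = 1/2 <grad Q_t, grad Q_t> is an identity of formal power series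
   in t at each point z of U, with grad acting on the coefficients. *)
Definition power_series_solution (K : numFieldType) (n : nat)
    (U : set 'rV[K]_n) (P : 'rV[K]_n -> K) (Q : nat -> 'rV[K]_n -> K) : Prop :=
  [/\ forall m z, U z -> differentiable (Q m) z,
      forall z, U z -> Q 0%N z = P z
    & forall z, U z -> forall k,
        fps_deriv (fun m => Q m z) k =
        2^-1 * \sum_(i < n) fps_mul (fun m => grad (Q m) z 0 i)
                                    (fun m => grad (Q m) z 0 i) k].

Section Arrangement.
Variables (R : realType) (n : nat) (A : finType).
Variables (u0 : A -> R) (u : A -> 'rV[R]_n) (lam : A -> R).

Definition hyp_form (h : A) (z : 'rV[cplx R]_n) : cplx R :=
  of_real (u0 h) + \sum_(i < n) of_real (u h 0 i) * z 0 i.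

Definition log_branch (U : set 'rV[cplx R]_n) (f L : 'rV[cplx R]_n -> cplx R)
    : Prop :=
  forall z, U z -> {for z, continuous L} /\ cexp (L z) = f z.

Definition master_function (L : A -> 'rV[cplx R]_n -> cplx R)
    (z : 'rV[cplx R]_n) : cplx R :=
  \sum_(h : A) of_real (lam h) * L h z.

End Arrangement.

(* A simple graph on 'I_k is given by its adjacency relation, so each edge
   {v, w} of it is stored as both (v, w) and (w, v). *)
Definition graph (k : nat) : finType := {set 'I_k * 'I_k}.

Definition adj (k : nat) (T : graph k) : rel 'I_k := fun v w => (v, w) \in T.

(* A cyclic sequence of distinct vertices of length 2 is just an edge
   traversed back and forth, hence the bound in the acyclicity clause. *)
Definition is_tree (k : nat) (T : graph k) : Prop :=
  [/\ symmetric (adj T), irreflexive (adj T),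
      forall v w, connect (adj T) v w
    & forall p : seq 'I_k, ucycle (adj T) p -> (size p <= 2)%N].

Definition giso (k : nat) (T T' : graph k) : bool :=
  [exists s : {perm 'I_k}, [forall v, [forall w,
     adj T' (s v) (s w) == adj T v w]]].

Definition trees (k : nat) : {set graph k} := [set T : graph k | `[< is_tree T >]]%SET.

Definition tree_classes (k : nat) : {set {set graph k}} :=
  equivalence_partition (@giso k) (trees k).

(* The condition v < w selects each undirected edge once. *)
Definition tree_weight (R : realType) (n : nat) (A : finType)
    (u0 : A -> R) (u : A -> 'rV[R]_n) (lam : A -> R)
    (k : nat) (T : graph k) (z : 'rV[cplx R]_n) : cplx R :=
  \sum_(h : {ffun 'I_k -> A})
     (\prod_(v < k) of_real (lam (h v))) *
     \prod_(e : 'I_k * 'I_k | (e.1 < e.2)%N && adj T e.1 e.2)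
        (of_real (dotp (u (h e.1)) (u (h e.2))) /
         (hyp_form u0 u (h e.1) z * hyp_form u0 u (h e.2) z)).

Definition graph_of_edges (k : nat) (s : seq (nat * nat)) : graph k :=
  [set e : 'I_k * 'I_k | ((val e.1, val e.2) \in s)
                      || ((val e.2, val e.1) \in s)]%SET.

Definition chain_edges (s : seq nat) : seq (nat * nat) := zip s (behead s).

Definition path_tree (r : nat) : graph r :=
  graph_of_edges r (chain_edges (iota 0%N r)).

(* The centre is 0; the vertices of the legs are numbered consecutively from
   [start] on, each leg outwards from the centre. *)
Fixpoint leg_edges (start : nat) (l : seq nat) : seq (nat * nat) :=
  if l is a :: l' then
    chain_edges (0%N :: iota start a) ++ leg_edges (start + a)%N l'
  else [::].

Definition spider (l : seq nat) : graph (sumn l).+1 :=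
  graph_of_edges (sumn l).+1 (leg_edges 1%N l).

Definition double_star : graph 6 :=
  graph_of_edges 6 [:: (0, 1); (0, 2); (0, 3); (1, 4); (1, 5)]%N.

(* Main.v *)
(* The derivative of W_T along z is - sum_v deg(v) V_{T,v}, where V_{T,v} is the
   vector obtained from W_T by inserting u_{h_v} / f_{h_v} into each term, and
   <V_{S,v}, V_{T,w}> is the weight of the tree obtained by joining S and T by
   an edge from v to w.  Hence the recurrence (1) turns expansions of Q^[i] over
   trees into expansions of Q^[m] over the joined trees, and by induction
     Q^[m] = (-1)^(m+1) / (2^m m!) * sum_(N, s) N W_s
   for an explicit list [tree_expansion m] of multiplicities N and trees s, the
   latter given by their edges; c_T collects the terms with s isomorphic to T.
   The induction starts with grad P = sum_h lam_h u_h / f_h, for which each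
   branch of log f_h must be differentiated: a continuous L with exp L = f
   satisfies L' = f' / f because (exp d - 1) / d tends to 1 as d tends to 0. *)
Require Import Defs.
From HB Require Import structures.
From mathcomp Require Import all_boot all_order all_algebra all_fingroup.
From mathcomp Require Import complex.
From mathcomp Require Import all_classical all_reals all_analysis.
From mathcomp Require Import ring lra.

Set Implicit Arguments.
Unset Strict Implicit.
Unset Printing Implicit Defensive.

Import Order.TTheory GRing.Theory Num.Theory.
Import numFieldNormedType.Exports.

Local Open Scope classical_set_scope.
Local Open Scope ring_scope.
Local Open Scope complex_scope.

(** The factor 1 / (2^m m!) clears all denominators: m + 1 and the 1/2 of the recurrence cancel, and
    the factorials leave the binomial C(m, i). The multiplicities are therefore natural numbers
    given by an integer recurrence, and the coefficients of low order come from plain evaluation. P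
    itself is not a sum of tree weights, but only gradients enter the recurrence, and grad P is the
    vector V attached to the single vertex. The induction hence carries a formula for the gradients,
    valid from m = 0 on. Trees occur in two forms. Graphs on ['I_k] carry the meaning: weights,
    acyclicity, isomorphism. Edge lists are what is executed. Joining, degree and isomorphism test
    on lists are each proved to agree with their counterparts on graphs. *)

(** * The complex exponential at 0 and the derivative of a branch of the logarithm *)

Lemma derive0_bound (R : realType) (f : R -> R) (l : R) :
  is_derive (0 : R) (1 : R) f l -> forall e : R, 0 < e ->
  exists2 r : R, 0 < r &
    forall x : R, `|x| < r -> `|f x - f 0 - x * l| <= e * `|x|.
Proof.
move=> [dfx dfl] e e0.
have : (fun h : R => h^-1 *: ((f \o shift (0 : R)) (h *: (1 : R)) - f 0)) @ 0^'
   --> l by rewrite -dfl; apply: dfx.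
move/cvgrPdist_lt => /(_ e e0) [r /= r0 rP]; exists r => // x xr.
have [->|x0] := eqVneq x 0; first by rewrite mul0r !subrr normr0 mulr0.
have := rP x; rewrite /= sub0r normrN => /(_ xr x0).
rewrite /= addr0 [x *: _]mulr1 => H.
rewrite (_ : _ - _ = - (x * (l - x^-1 *: (f x - f 0)))); last first.
  by rewrite mulrBr -[_ *: _]/(_ * _) mulrA divff // mul1r opprB.
by rewrite normrN normrM mulrC ler_pM2r ?normr_gt0 // ltW.
Qed.

Lemma cplx_normE (R : realType) (d : cplx R) : `|d| = of_real (Normc.normc d).
Proof. by []. Qed.

Lemma cplx_le_real (R : realType) (x y : R) :
  (of_real x <= of_real y) = (x <= y).
Proof. by rewrite /of_real lecR. Qed.

Lemma Re_le_normc (R : realType) (d : cplx R) : `|complex.Re d| <= Normc.normc d.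
Proof.
by have := normc_ge_Re d; rewrite -[X in _ <= X]/(of_real _) cplx_le_real.
Qed.

Lemma Im_le_normc (R : realType) (d : cplx R) : `|complex.Im d| <= Normc.normc d.
Proof.
by case: d => a b /=; rewrite -sqrtr_sqr ler_wsqrtr // lerDr sqr_ge0.
Qed.

Lemma normc_le_ReIm (R : realType) (d : cplx R) :
  Normc.normc d <= `|complex.Re d| + `|complex.Im d|.
Proof.
case: d => a b /=; rewrite -[leRHS]ger0_norm ?addr_ge0 // -sqrtr_sqr.
rewrite ler_wsqrtr // sqrrD !real_normK ?num_real //.
by rewrite addrAC lerDl mulrn_wge0 // mulr_ge0.
Qed.

Lemma cexpD (R : realType) (a b : cplx R) : cexp (a + b) = cexp a * cexp b.
Proof.
case: a => a1 a2; case: b => b1 b2; rewrite /cexp /=.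
rewrite expRD cosD sinD; simpc; congr (_ +i* _); ring.
Qed.

Lemma cexp0 (R : realType) : cexp (0 : cplx R) = 1.
Proof. by rewrite /cexp /= expR0 cos0 sin0 mulr1 mulr0. Qed.

Lemma cexp_neq0 (R : realType) (a : cplx R) : cexp a != 0.
Proof.
apply/eqP => H; have := cexpD a (- a); rewrite H mul0r subrr cexp0.
by move/eqP; rewrite oner_eq0.
Qed.

(** Real and imaginary parts are estimated separately from the first-order expansions of [expR],
    [cos] and [sin] at 0; what remains are products of two small quantities. *)
Lemma cexp_linearization (R : realType) (e : R) : 0 < e ->
  \forall d \near (0 : cplx R), `|cexp d - 1 - d| <= of_real e * `|d|.
Proof.
(* The real part costs at most 3 e' D and the imaginary part 4 e' D, where D is the modulus of d; 8
   leaves room. The cap at 1 gives |1 + a| <= 2. *)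
move=> e0; pose e' := Num.min (e / 8) 1.
have e'0 : 0 < e' by rewrite lt_min ltr01 divr_gt0.
have e'1 : e' <= 1 by rewrite ge_min lexx orbT.
have e'e : 8 * e' <= e by rewrite mulrC -ler_pdivlMr // ge_min lexx.
clearbody e'.
have [r1 r10 H1] := @derive0_bound R expR (expR 0) _ e' e'0.
have [r2 r20 H2] := @derive0_bound R cos (- sin 0) _ e' e'0.
have [r3 r30 H3] := @derive0_bound R sin (cos 0) _ e' e'0.
(* Including [e'] forces |a| < e', which makes the cross term a * b at most e' D. *)
pose r := Num.min e' (Num.min r1 (Num.min r2 r3)).
have r0 : 0 < r by rewrite /r !lt_min e'0 r10 r20.
exists (of_real r); first by rewrite /= /of_real ltcR.
move=> d /=; rewrite sub0r normrN !cplx_normE /of_real ltcR -rmorphM /= lecR.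
set D := Normc.normc d => Dr.
have := Re_le_normc d; have := Im_le_normc d; rewrite -/D.
set a := complex.Re d; set b := complex.Im d => bD aD.
have := le_lt_trans aD Dr; rewrite !lt_min => /and4P[ae /H1 {}H1 _ _].
have := le_lt_trans bD Dr; rewrite !lt_min => /and4P[_ _ /H2 {}H2 /H3 {}H3].
move: H1 H2 H3; rewrite expR0 cos0 sin0 oppr0 !mulr0 !mulr1 !subr0 ?addr0.
move=> H1 H2 H3.
apply: le_trans (normc_le_ReIm _) _.
have -> : complex.Re (cexp d - 1 - d) =
    (expR a - 1 - a) * cos b + (1 + a) * (cos b - 1).
  by rewrite /a /b; case: (d) => x y; rewrite /cexp /=; ring.
have -> : complex.Im (cexp d - 1 - d) =
    (expR a - 1 - a) * sin b + (1 + a) * (sin b - b) + a * b.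
  by rewrite /a /b; case: (d) => x y; rewrite /cexp /=; ring.
have a1 : `|1 + a| <= 2.
  by rewrite (le_trans (ler_normD _ _)) // normr1 -[2]/(1 + 1) lerD2l
    (le_trans (ltW ae)).
have cb : `|cos b| <= 1 by rewrite ler_norml cos_geN1 cos_le1.
have sb : `|sin b| <= 1 by rewrite ler_norml sin_geN1 sin_le1.
have aux x y z w : `|x| <= z -> `|y| <= w -> `|x * y| <= z * w :> R.
  by move=> xz yw; rewrite normrM ler_pM.
have D0 : 0 <= D by rewrite (le_trans _ aD).
have D1 : e' * `|a| <= e' * D by rewrite ler_pM2l.
have D2 : e' * `|b| <= e' * D by rewrite ler_pM2l.
have K1 := aux _ _ _ _ H1 cb; have K2 := aux _ _ _ _ a1 H2.
have K3 := aux _ _ _ _ H1 sb; have K4 := aux _ _ _ _ a1 H3.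
have K5 := aux _ _ _ _ (ltW ae) bD.
have K6 : 8 * e' * D <= e * D by rewrite ler_wpM2r.
have K7 : 0 <= e' * D by rewrite mulr_ge0 // ltW.
have T1 := ler_normD ((expR a - 1 - a) * cos b) ((1 + a) * (cos b - 1)).
have T2 := ler_normD ((expR a - 1 - a) * sin b + (1 + a) * (sin b - b)) (a * b).
have T3 := ler_normD ((expR a - 1 - a) * sin b) ((1 + a) * (sin b - b)).
lra.
Qed.

(** Limits in [cplx R] quantify over complex tolerances, but the order is partial and [0 < e] forces
    [e] to be real. *)
Lemma cexp_near (R : realType) (e : cplx R) : 0 < e ->
  \forall d \near (0 : cplx R), `|cexp d - 1 - d| <= e * `|d|.
Proof.
case: e => a b; rewrite ltcE /= => /andP[/eqP-> a0].
exact: (@cexp_linearization R a a0).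
Qed.

Lemma log_branch_neq0 (R : realType) n (U : set 'rV[cplx R]_n)
    (f L : 'rV[cplx R]_n -> cplx R) z :
  log_branch U f L -> U z -> f z != 0.
Proof. by move=> UL /UL[_ <-]; exact: cexp_neq0. Qed.

(** Continuity of L makes its increment [delta h] tend to 0. Dividing exp (L (line h)) = f (line h)
    by exp (L z) = f z gives exp (delta h) - 1 = h q(h) with q(h) tending to df / f z, and the
    linearization of exp compares [delta h] with h q(h). *)
Lemma log_branch_is_derive (R : realType) n (U : set 'rV[cplx R]_n)
    (f L : 'rV[cplx R]_n -> cplx R) (z v : 'rV[cplx R]_n) (df : cplx R) :
  open U -> log_branch U f L -> U z -> is_derive z v f df ->
  is_derive z v L (df / f z).
Proof.
move=> oU UL Uz [dfz dfE]; have fz0 := log_branch_neq0 UL Uz.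
pose line (h : cplx R) := h *: v + z.
have line0 : line @ (0 : cplx R) --> z.
  rewrite -[X in _ --> X]add0r -(scale0r v).
  have idc : id @ (0 : cplx R) --> (0 : cplx R) by exact: cvg_id.
  exact: (cvgD (cvgZr_tmp (a := v) idc) (cvg_cst z)).
pose delta h := L (line h) - L z.
have delta0 : delta @ (0 : cplx R) --> (0 : cplx R).
  have [Lc _] := UL z Uz; rewrite -[X in _ --> X](subrr (L z)).
  have H := cvg_comp _ _ line0 Lc.
  exact: (cvgB H (cvg_cst (L z))).
pose q h := h^-1 * (f (line h) - f z) / f z.
have q_cvg : q @ 0^' --> df / f z.
  by apply: cvgM; [rewrite -dfE; exact: dfz|exact: cvg_cst].
have cexp_delta : \forall h \near (0 : cplx R)^', cexp (delta h) - 1 = h * q h.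
  have [_ Lz] := UL z Uz.
  have : \forall h \near (0 : cplx R), U (line h).
    by apply: line0; exact: open_nbhs_nbhs.
  move=> nU; near=> h.
  have h0 : h != 0 by near: h; exact: nbhs_dnbhs_neq.
  have [_ Lh] : {for line h, continuous L} /\ cexp (L (line h)) = f (line h).
    by apply: UL; near: h; exact: nbhs_dnbhs.
  rewrite /q !mulrA divff // mul1r mulrBl divff // -Lh -Lz.
  have -> : cexp (L (line h)) = cexp (delta h) * cexp (L z).
    by rewrite -cexpD subrK.
  by rewrite mulfK ?cexp_neq0.
have err : (fun h => h^-1 * delta h - q h) @ 0^' --> (0 : cplx R).
  apply/cvgrPdist_le => e e0.
  pose K := `|df / f z| + 1.
  have K0 : 0 < K by rewrite ltr_wpDl.
  have Ke0 : 0 < 2 * (K + e) by rewrite mulr_gt0 // addr_gt0.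
  (* One choice for two needs: e1 <= 1/2 to absorb |delta h| below, and 2 K e1 <= e for the final
     bound. *)
  pose e1 := e / (2 * (K + e)).
  have e10 : 0 < e1 by rewrite divr_gt0.
  have e1h : e1 <= 1 / 2.
    rewrite ler_pdivrMr // mulrA mul1r mulVf ?pnatr_eq0 // mul1r.
    by rewrite lerDr ltW.
  have e1e : e1 * (2 * K) <= e.
    rewrite mulrAC ler_pdivrMr // ler_pM2l // ler_pM2l //.
    by rewrite lerDl ltW.
  clearbody e1.
  have nq : \forall h \near (0 : cplx R)^', `|q h| <= K.
    have /cvgrPdist_le/(_ 1 ltr01) := q_cvg.
    apply: filterS => h H; rewrite -(subrK (df / f z) (q h)) addrC.
    by rewrite (le_trans (ler_normD _ _)) // /K lerD2l distrC.
  have nd := cexp_near e10; have {}nd := delta0 _ nd.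
  near=> h.
  have h0 : h != 0 by near: h; exact: nbhs_dnbhs_neq.
  have Kq : `|q h| <= K by near: h.
  have cd : cexp (delta h) - 1 = h * q h by near: h.
  have lin : `|cexp (delta h) - 1 - delta h| <= e1 * `|delta h|.
    by near: h; exact: nbhs_dnbhs.
  (* The linearization error is at most half of |delta h| and is absorbed on the left. This yields a
     bound of order |h| although L is only known to be continuous. *)
  have D2 : `|delta h| <= 2 * `|h * q h|.
    have : `|delta h| <= `|h * q h| + 1 / 2 * `|delta h|.
      rewrite -cd -{1}(subKr (cexp (delta h) - 1) (delta h)).
      rewrite (le_trans (ler_normB _ _)) // lerD2l.
      by rewrite (le_trans lin) // ler_wpM2r.
    rewrite -lerBlDr -{1}[`|delta h|]mul1r -mulrBl.
    rewrite (_ : 1 - 1 / 2 = 2^-1); last by field.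
    by rewrite mulrC ler_pdivrMr // mulrC.
  rewrite sub0r normrN -(ler_pM2l (_ : 0 < `|h|)) ?normr_gt0 // -normrM.
  rewrite mulrBr mulrA divff // mul1r distrC -cd (le_trans lin) //.
  rewrite (le_trans (ler_wpM2l (ltW e10) D2)) // normrM mulrCA !mulrA.
  rewrite [_ * `|h|]mulrC -!mulrA ler_pM2l ?normr_gt0 //.
  by rewrite mulrCA (le_trans _ e1e) // ler_pM2l // ler_pM2l.
have lim : (fun h => h^-1 *: ((L \o shift z) (h *: v) - L z)) @ 0^' --> df / f z.
  have H := cvgD err q_cvg; rewrite add0r in H.
  suff -> : (fun h => h^-1 *: ((L \o shift z) (h *: v) - L z)) =
      (fun h => h^-1 * delta h - q h) + q by exact: H.
  by apply/funext => h; rewrite /= [RHS]subrK.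
by apply: DeriveDef; [exact: cvgP lim|exact: cvg_lim lim].
Unshelve. all: by end_near. Qed.

(** * Rules for directional derivatives of sums, products and quotients *)

Section Derivatives.
Variables (K : numFieldType) (V : normedModType K).
Implicit Types (z v : V) (f g : V -> K).

Lemma is_derive_affine f z v (c : K) :
  (forall h, f (h *: v + z) = f z + h * c) -> is_derive z v f c.
Proof.
move=> fE.
have lim : (fun h => h^-1 *: ((f \o shift z) (h *: v) - f z)) @ 0^' --> c.
  apply/cvgrPdist_le => e e0; near=> h.
  have h0 : h != 0 by near: h; exact: nbhs_dnbhs_neq.
  rewrite /= fE [f z + _]addrC addrK -[_ *: _]/(_ * _) mulrA mulVf //.
  rewrite mul1r subrr normr0.
  exact: ltW.
by apply: DeriveDef; [exact: cvgP lim|exact: cvg_lim lim].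
Unshelve. all: by end_near. Qed.

Lemma is_derive_big_sum (I : Type) (r : seq I) (P : pred I) (F : I -> V -> K)
    (dF : I -> K) z v :
  (forall i, P i -> is_derive z v (F i) (dF i)) ->
  is_derive z v (fun x => \sum_(i <- r | P i) F i x) (\sum_(i <- r | P i) dF i).
Proof.
move=> FdF; elim: r => [|i r IH].
  rewrite big_nil (_ : (fun x => _) = cst 0); first exact: is_derive_cst.
  by apply/funext => x; rewrite big_nil.
rewrite big_cons; case: ifP => Pi; last first.
  rewrite (_ : (fun x => _) = fun x => \sum_(j <- r | P j) F j x) //.
  by apply/funext => x; rewrite big_cons Pi.
rewrite (_ : (fun x => _) = F i + fun x => \sum_(j <- r | P j) F j x).
  by apply: is_deriveD => //; exact: FdF.
by apply/funext => x; rewrite big_cons Pi.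
Qed.

(** Logarithmic differentiation with the factor kept in front instead of divided out: the factor of
    an edge vanishes when the two normal vectors are orthogonal. *)
Lemma is_derive_prod_log (I : Type) (r : seq I) (P : pred I) (F : I -> V -> K)
    (dF : I -> K) z v :
  (forall i, P i -> is_derive z v (F i) (F i z * dF i)) ->
  is_derive z v (fun x => \prod_(i <- r | P i) F i x)
    ((\prod_(i <- r | P i) F i z) * \sum_(i <- r | P i) dF i).
Proof.
move=> FdF; elim: r => [|i r IH].
  rewrite !big_nil mulr0 (_ : (fun x => _) = cst 1); first exact: is_derive_cst.
  by apply/funext => x; rewrite big_nil.
rewrite !big_cons; case: ifP => Pi; last first.
  rewrite (_ : (fun x => _) = fun x => \prod_(j <- r | P j) F j x) //.
  by apply/funext => x; rewrite big_cons Pi.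
rewrite (_ : (fun x => _) = F i * fun x => \prod_(j <- r | P j) F j x).
  apply: (is_derive_eq (is_deriveM (FdF i Pi) IH)).
  by rewrite -![_ *: _]/(_ * _); ring.
by apply/funext => x; rewrite big_cons Pi.
Qed.

Lemma is_derive_scale (c : K) f z v df :
  is_derive z v f df -> is_derive z v (fun x => c * f x) (c * df).
Proof. by move=> fdf; exact: (is_deriveZ c fdf). Qed.

(** The factor of one edge, with its derivative in the shape that [is_derive_prod_log] expects; [c]
    may be 0. *)
Lemma is_derive_div_mul (c : K) f g z v df dg :
  is_derive z v f df -> is_derive z v g dg -> f z != 0 -> g z != 0 ->
  is_derive z v (fun x => c / (f x * g x))
    (c / (f z * g z) * - (df / f z + dg / g z)).
Proof.
move=> fdf gdg f0 g0; have [dm dmE] := is_deriveM fdf gdg.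
have fg0 : (f * g) z != 0 by rewrite /= mulf_neq0.
have iv : is_derive z v (fun x => (f x * g x)^-1)
    (- ((f z * g z) ^- 2) * (f z * dg + g z * df)).
  by apply: DeriveDef; [exact: derivableV|rewrite (deriveV fg0 dm) dmE].
apply: (is_derive_eq (is_derive_scale c iv)).
by field; apply/andP.
Qed.

End Derivatives.

(** * Joining two graphs by an edge, and labellings of the joined vertex set *)

Definition graph_join (k1 k2 : nat) (T1 : graph k1) (T2 : graph k2)
    (v : 'I_k1) (w : 'I_k2) : graph (k1 + k2) :=
  [set e : 'I_(k1 + k2) * 'I_(k1 + k2) |
     match fintype.split e.1, fintype.split e.2 with
     | inl a, inl b => adj T1 a b
     | inr a, inr b => adj T2 a b
     | inl a, inr b => (a == v) && (b == w)
     | inr a, inl b => (b == v) && (a == w)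
     end]%SET.

Section GraphJoin.
Variables (k1 k2 : nat) (T1 : graph k1) (T2 : graph k2).
Variables (v : 'I_k1) (w : 'I_k2).
Let T := graph_join T1 T2 v w.

Lemma adj_join_ll a b : adj T (lshift k2 a) (lshift k2 b) = adj T1 a b.
Proof.
by rewrite {1}/adj inE /= -!/(unsplit (inl _)) !unsplitK.
Qed.

Lemma adj_join_rr a b : adj T (rshift k1 a) (rshift k1 b) = adj T2 a b.
Proof. by rewrite {1}/adj inE /= -!/(unsplit (inr _)) !unsplitK. Qed.

Lemma adj_join_lr a b : adj T (lshift k2 a) (rshift k1 b) = (a == v) && (b == w).
Proof.
by rewrite {1}/adj inE /= -!/(unsplit (inl _)) -!/(unsplit (inr _)) !unsplitK.
Qed.

Lemma adj_join_rl a b : adj T (rshift k1 a) (lshift k2 b) = (b == v) && (a == w).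
Proof.
by rewrite {1}/adj inE /= -!/(unsplit (inl _)) -!/(unsplit (inr _)) !unsplitK.
Qed.

End GraphJoin.

Definition ffun_cat (A : Type) (k1 k2 : nat)
    (p : {ffun 'I_k1 -> A} * {ffun 'I_k2 -> A}) : {ffun 'I_(k1 + k2) -> A} :=
  [ffun x => match fintype.split x with inl a => p.1 a | inr b => p.2 b end].

Lemma ffun_catl (A : Type) k1 k2 (p : {ffun 'I_k1 -> A} * {ffun 'I_k2 -> A}) a :
  ffun_cat p (lshift k2 a) = p.1 a.
Proof. by rewrite ffunE -/(unsplit (inl _)) unsplitK. Qed.

Lemma ffun_catr (A : Type) k1 k2 (p : {ffun 'I_k1 -> A} * {ffun 'I_k2 -> A}) b :
  ffun_cat p (rshift k1 b) = p.2 b.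
Proof. by rewrite ffunE -/(unsplit (inr _)) unsplitK. Qed.

Lemma ffun_cat_bij (A : Type) k1 k2 : bijective (@ffun_cat A k1 k2).
Proof.
exists (fun h : {ffun 'I_(k1 + k2) -> A} =>
  ([ffun a => h (lshift k2 a)], [ffun b => h (rshift k1 b)])).
  case=> h1 h2; congr (_, _); apply/ffunP => x;
  by rewrite ffunE ?ffun_catl ?ffun_catr.
move=> h; apply/ffunP => x; rewrite -(splitK x).
by case: fintype.split => y /=; rewrite ?ffun_catl ?ffun_catr !ffunE.
Qed.

Lemma big_ffun_cat (K : nmodType) (A : finType) k1 k2
    (F : {ffun 'I_(k1 + k2) -> A} -> K) :
  \sum_h F h = \sum_(h1 : {ffun 'I_k1 -> A}) \sum_(h2 : {ffun 'I_k2 -> A})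
     F (ffun_cat (h1, h2)).
Proof.
by rewrite (reindex (@ffun_cat A k1 k2)) ?pair_bigA; [apply: eq_bigr; case|
  exact/onW_bij/ffun_cat_bij].
Qed.

(** * Tree weights: derivative, behaviour under joining, invariance under isomorphism *)

Definition gdeg (k : nat) (T : graph k) (v : 'I_k) : nat :=
  #|[pred w | adj T v w]|.

(** Handshake count: turning the edges around in the second half of the sum leaves a sum over all
    ordered adjacent pairs, in which [x v] occurs once per neighbour of [v]. *)
Lemma sum_edges_gdeg (K : pzRingType) (k : nat) (T : graph k) (x : 'I_k -> K) :
  symmetric (adj T) -> irreflexive (adj T) ->
  \sum_(e : 'I_k * 'I_k | (e.1 < e.2)%N && adj T e.1 e.2) (x e.1 + x e.2) =
  \sum_v (gdeg T v)%:R * x v.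
Proof.
move=> Tsym Tirr; rewrite big_split /=.
rewrite [X in _ + X](reindex (fun e : 'I_k * 'I_k => (e.2, e.1))) /=; last first.
  by exists (fun e => (e.2, e.1)); case.
transitivity (\sum_(e : 'I_k * 'I_k | adj T e.1 e.2) x e.1).
  rewrite [RHS](bigID (fun e : 'I_k * 'I_k => (e.1 < e.2)%N)) /=; congr (_ + _).
    by apply: eq_bigl => e; rewrite andbC.
  apply: eq_bigl => -[a b] /=; rewrite Tsym andbC; case: ltngtP => //.
  by move=> /ord_inj ->; rewrite Tirr.
rewrite big_mkcond -(pair_bigA _ (fun a b => if adj T a b then x a else 0)) /=.
apply: eq_bigr => v _; rewrite -big_mkcond /= sumr_const.
by rewrite mulr_natl; congr (_ *+ _); apply: eq_card.
Qed.

Section TreeWeight.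
Variables (R : realType) (n : nat) (A : finType).
Variables (u0 : A -> R) (u : A -> 'rV[R]_n) (lam : A -> R).
Local Notation K := (cplx R).
Local Notation f := (hyp_form u0 u).

Definition weight_term (k : nat) (T : graph k) (h : {ffun 'I_k -> A})
    (z : 'rV[K]_n) : K :=
  (\prod_(v < k) of_real (lam (h v))) *
  \prod_(e : 'I_k * 'I_k | (e.1 < e.2)%N && adj T e.1 e.2)
     (of_real (dotp (u (h e.1)) (u (h e.2))) / (f (h e.1) z * f (h e.2) z)).

(** The [i]-th component of the vector V_{T,v}. *)
Definition pointed_weight (k : nat) (T : graph k) (v : 'I_k) (z : 'rV[K]_n)
    (i : 'I_n) : K :=
  \sum_(h : {ffun 'I_k -> A})
     weight_term T h z * (of_real (u (h v) 0 i) / f (h v) z).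

Lemma is_derive_hyp_form h (z : 'rV[K]_n) i :
  is_derive z (delta_mx 0 i) (f h) (of_real (u h 0 i)).
Proof.
apply: is_derive_affine => c; rewrite /hyp_form -addrA; congr (_ + _).
transitivity (\sum_(j < n) (of_real (u h 0 j) * z 0 j +
   (if j == i then c * of_real (u h 0 i) else 0))).
  apply: eq_bigr => j _; rewrite !mxE eqxx /= addrC mulrDr; congr (_ + _).
  by case: eqVneq => [->|]; rewrite ?mulr1 ?mulr0 // mulrC.
by rewrite big_split /= -big_mkcond big_pred1_eq.
Qed.

Lemma is_derive_tree_weight (k : nat) (T : graph k) (z : 'rV[K]_n) i :
  symmetric (adj T) -> irreflexive (adj T) -> (forall h, f h z != 0) ->
  is_derive z (delta_mx 0 i) (tree_weight u0 u lam T)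
    (- \sum_v (gdeg T v)%:R * pointed_weight T v z i).
Proof.
move=> Tsym Tirr f0.
pose x h := of_real (u h 0 i) / f h z.
have dterm (h : {ffun 'I_k -> A}) : is_derive z (delta_mx 0 i)
    (weight_term T h)
    (weight_term T h z * - \sum_v (gdeg T v)%:R * x (h v)).
  rewrite -(sum_edges_gdeg (x \o h)) // -sumrN -mulrA.
  apply: is_derive_scale; apply: is_derive_prod_log => e _.
  by apply: is_derive_div_mul => //; exact: is_derive_hyp_form.
apply: (is_derive_eq (is_derive_big_sum _ (fun h _ => dterm h))).
under eq_bigr => h _ do rewrite mulrN mulr_sumr.
rewrite sumrN exchange_big /=; congr (- _); apply: eq_bigr => v _.
by rewrite mulr_sumr; apply: eq_bigr => h _; rewrite mulrCA.
Qed.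

(** The pairs of vertices fall into four blocks. Left vertices precede all right ones, so the
    condition e.1 < e.2 empties the right-left block, while the left-right block holds just the new
    edge. *)
Lemma weight_term_join (k1 k2 : nat) (T1 : graph k1) (T2 : graph k2) v w h1 h2 z :
  weight_term (graph_join T1 T2 v w) (ffun_cat (h1, h2)) z =
  weight_term T1 h1 z * weight_term T2 h2 z *
   (of_real (dotp (u (h1 v)) (u (h2 w))) / (f (h1 v) z * f (h2 w) z)).
Proof.
rewrite /weight_term big_split_ord /=.
under eq_bigr => a _ do rewrite ffun_catl.
under [in X in _ * X * _ = _]eq_bigr => a _ do rewrite ffun_catr.
rewrite [X in _ = X * _]mulrACA -[RHS]mulrA; congr (_ * _).
pose g a b := of_real (dotp (u a) (u b)) / (f a z * f b z).
have E k (T : graph k) (h : {ffun 'I_k -> A}) :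
  \prod_(e : 'I_k * 'I_k | (e.1 < e.2)%N && adj T e.1 e.2)
     (of_real (dotp (u (h e.1)) (u (h e.2))) / (f (h e.1) z * f (h e.2) z)) =
  \prod_(a < k) \prod_(b < k)
     if (a < b)%N && adj T a b then g (h a) (h b) else 1.
  by rewrite big_mkcond pair_bigA.
rewrite !E big_split_ord /=.
under eq_bigr => a _.
  rewrite big_split_ord /=.
  under eq_bigr => b _ do rewrite adj_join_ll !ffun_catl.
  under [X in _ * X]eq_bigr => b _.
    rewrite adj_join_lr ffun_catl ffun_catr /= ltn_addr //; over.
  over.
under [X in _ * X = _]eq_bigr => a _.
  rewrite big_split_ord /=.
  under eq_bigr => b _.
    rewrite ltnNge (leq_trans (ltnW (ltn_ord b))) ?leq_addr //=; over.
  rewrite big1 // mul1r.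
  under eq_bigr => b _ do rewrite adj_join_rr !ffun_catr ltn_add2l.
  over.
rewrite big_split /= mulrAC; congr (_ * _ * _).
(* In the mixed block only the pair (v, w) contributes a factor other than 1. *)
rewrite (bigD1 v) //= (bigD1 w) //= !eqxx /= !big1 ?mulr1 //.
  move=> a av; apply: big1 => b _; by rewrite (negbTE av).
by move=> b /negbTE bw; rewrite bw.
Qed.

Lemma pointed_weight_join (k1 k2 : nat) (T1 : graph k1) (T2 : graph k2) v w z :
  \sum_(i < n) pointed_weight T1 v z i * pointed_weight T2 w z i =
  tree_weight u0 u lam (graph_join T1 T2 v w) z.
Proof.
rewrite [RHS]big_ffun_cat /=.
under eq_bigr => i _ do rewrite mulr_suml.
rewrite exchange_big /=; apply: eq_bigr => h1 _.
under eq_bigr => i _ do rewrite mulr_sumr.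
rewrite exchange_big /=; apply: eq_bigr => h2 _.
rewrite -/(weight_term (graph_join T1 T2 v w) (ffun_cat (h1, h2)) z).
rewrite weight_term_join /dotp /of_real rmorph_sum /= mulr_suml mulr_sumr.
apply: eq_bigr => i _; rewrite rmorphM /= invfM; ring.
Qed.

(** Relabelling by the isomorphism [s] matches the terms, except that [s] need not respect the order
    used to select each edge once. The edge factor is symmetric, so a reversed edge may be turned
    around. *)
Lemma tree_weight_giso (k : nat) (T T' : graph k) z :
  symmetric (adj T) -> giso T T' ->
  tree_weight u0 u lam T z = tree_weight u0 u lam T' z.
Proof.
move=> Tsym /existsP[s /forallP sP].
have adjs v w : adj T' (s v) (s w) = adj T v w.
  by have /forallP/(_ w)/eqP := sP v.
rewrite {2}/tree_weight (reindex (fun h : {ffun 'I_k -> A} =>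
  [ffun x => h ((s^-1)%g x)])); last first.
  exists (fun h : {ffun 'I_k -> A} => [ffun x => h (s x)]) => h _; apply/ffunP => x;
    by rewrite !ffunE ?permKV ?permK.
apply: eq_bigr => h _; congr (_ * _).
  rewrite [RHS](reindex_inj (@perm_inj _ s)); apply: eq_bigr => v _.
  by rewrite ffunE permK.
pose g a b := of_real (dotp (u (h a)) (u (h b))) / (f (h a) z * f (h b) z).
have gC a b : g a b = g b a.
  rewrite /g mulrC [_ * f _ z]mulrC mulrC; congr (of_real _ / _).
  by apply: eq_bigr => i _; rewrite mulrC.
under [RHS]eq_bigr => e _ do rewrite !ffunE -/(g _ _).
rewrite [RHS](reindex (fun e : 'I_k * 'I_k => (s e.1, s e.2))) /=; last first.
  exists (fun e => ((s^-1)%g e.1, (s^-1)%g e.2)) => -[a b] _ /=;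
    by rewrite ?permKV ?permK.
under [RHS]eq_bigl => e do rewrite adjs.
under [RHS]eq_bigr => e _ do rewrite !permK.
(* Both products are split into the edges whose order [s] keeps, which agree at once, and those
   whose order it reverses, which agree after swapping the endpoints. *)
rewrite (bigID (fun e : 'I_k * 'I_k => (s e.1 < s e.2)%N)) /=.
rewrite [RHS](bigID (fun e : 'I_k * 'I_k => (e.1 < e.2)%N)) /=.
congr (_ * _); first apply: eq_bigl => e.
  by case: (adj _ _ _); rewrite ?andbT ?andbF // andbC.
rewrite [RHS](reindex (fun e : 'I_k * 'I_k => (e.2, e.1))) /=; last first.
  by exists (fun e => (e.2, e.1)); case.
apply: eq_big => -[a b] /=; last by move=> _; exact: gC.
rewrite Tsym -!leqNgt; case: (adj T b a); rewrite ?andbF // !andbT.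
rewrite [(a <= b)%N]leq_eqVlt [(s b <= s a)%N]leq_eqVlt.
case: (eqVneq a b) => [->|ab]; first by rewrite ltnn ltnn.
have -> : (s b == s a :> nat) = false.
  by apply/eqP => /ord_inj/perm_inj ba; rewrite ba eqxx in ab.
rewrite -val_eqE /= in ab; rewrite (negbTE ab) /=.
by rewrite andbC.
Qed.

End TreeWeight.

(** * Joining two trees by an edge gives a tree *)

Lemma connect_homo (T T' : finType) (e : rel T) (e' : rel T') (g : T -> T') :
  {homo g : x y / e x y >-> e' x y} ->
  {homo g : x y / connect e x y >-> connect e' x y}.
Proof.
move=> ge x y /connectP[p ep ->]; apply/connectP; exists (map g p).
  exact: homo_path ep.
by rewrite last_map.
Qed.

Section Bridge.
Variables (T : finType) (e : rel T) (S : pred T) (x0 y0 : T).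
Hypothesis e_sym : symmetric e.
Hypothesis bridge : forall x y, e x y -> S x -> ~~ S y -> x = x0 /\ y = y0.

(** A walk outside [S] can enter [S] only by stepping from [y0] to [x0], so it never reaches [x0] if
    it avoids [y0]. *)
Lemma bridge_no_return q y :
  S x0 -> ~~ S y -> y != y0 -> x0 \notin q -> y0 \notin q ->
  ~~ path e y (rcons q x0).
Proof.
move=> Sx0; elim: q y => [|a q IH] y Sy yy0 /=.
  move=> _ _; rewrite andbT; apply/negP; rewrite e_sym => /bridge/(_ Sx0 Sy)[_ yE].
  by rewrite yE eqxx in yy0.
rewrite !inE !negb_or => /andP[x0a x0q] /andP[y0a y0q].
apply/negP => /andP[eya]; apply/negP; apply: IH => //; last by rewrite eq_sym.
apply/negP => Sa; move: eya; rewrite e_sym => /bridge/(_ Sa Sy)[_ yE].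
by rewrite yE eqxx in yy0.
Qed.

(** A cycle that meets both sides crosses the bridge and must cross it again to close up; as its
    vertices are distinct, it consists of [x0] and [y0] alone. *)
Lemma bridge_ucycle p : ucycle e p ->
  [\/ all S p, all (predC S) p | (size p <= 2)%N].
Proof.
have [allS _|] := boolP (all S p); first by constructor 1.
have [allNS _ _|] := boolP (all (predC S) p); first by constructor 2.
rewrite -!has_predC => /hasP[x xp] /negPn Sx hasN ecp; constructor 3.
(* The cycle is rotated to start at a vertex [x] of [S]; then [y] is its first vertex outside [S],
   so the step into [y] is the bridge. *)
have [i p' pE] := rot_to xp.
rewrite -(size_rot i); move: ecp hasN; rewrite -(rot_ucycle i) -(has_rot i) pE.
case/andP => /= cyc uq; rewrite Sx /= => /split_find hs.
case: hs cyc uq => y s1 s2 /= Sy hs1.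
rewrite rcons_cat cat_path rcons_path last_rcons => /andP[/andP[p1 exy] p2].
rewrite cat_rcons => uq.
have allS1 : all S (x :: s1).
  rewrite /= Sx; apply/allP => a as1; apply/negPn/negP => Sa.
  by case/negP: hs1; apply/hasP; exists a.
have Sl : S (last x s1) by apply: (allP allS1); exact: mem_last.
have [lE yE] := bridge exy Sl Sy; subst y.
have cyc' : ucycle e (x :: s1 ++ y0 :: s2).
  rewrite /ucycle /= uq andbT rcons_cat cat_path p1 /= exy /=.
  by move: p2.
have {cyc'} : ucycle e (x0 :: y0 :: s2 ++ belast x s1).
  have <- : rot (size (belast x s1)) (x :: s1 ++ y0 :: s2) =
      x0 :: y0 :: s2 ++ belast x s1.
    rewrite -[x :: _]/((x :: s1) ++ y0 :: s2) {1}lastI cat_rcons.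
    by rewrite rot_size_cat lE.
  by rewrite rot_ucycle.
have -> : size (s1 ++ y0 :: s2) = (size (s2 ++ belast x s1)).+1.
  by rewrite !size_cat size_belast addnC.
(* A third vertex [a], following [y0], would lie outside [S], because [y0] has no neighbour in [S]
   other than the used [x0]. The rest of the cycle would then be a forbidden walk from [a] back to
   [x0]. *)
case: (s2 ++ belast x s1) => [//|a q].
move=> /andP[/= /and3P[_ e0a pth] /and4P[]].
rewrite !inE !negb_or => /and3P[x0y0 x0a x0q] /andP[y0a y0q] aq _.
have Sx0 : S x0 by rewrite -lE.
have Sa : ~~ S a.
  apply/negP => Sa; move: e0a; rewrite e_sym => /bridge/(_ Sa Sy)[aE _].
  by rewrite aE eqxx in x0a.
have ay0 : a != y0 by rewrite eq_sym.
by have := bridge_no_return Sx0 Sa ay0 x0q y0q; rewrite pth.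
Qed.

End Bridge.

Lemma map_preimage (T T' : eqType) (g : T -> T') (p : seq T') :
  (forall x, x \in p -> exists y, x = g y) -> exists q, p = map g q.
Proof.
elim: p => [|x p IH] H; first by exists [::].
have [y ->] := H x (mem_head _ _).
have [z zp|q ->] := IH; first by apply: H; rewrite inE zp orbT.
by exists (y :: q).
Qed.

Section TreeJoin.
Variables (k1 k2 : nat) (T1 : graph k1) (T2 : graph k2).
Variables (v : 'I_k1) (w : 'I_k2).
Let T := graph_join T1 T2 v w.
Local Notation inL := (@lshift k1 k2).
Local Notation inR := (@rshift k1 k2).

(** The new edge connects the two sides and is a bridge between them, so a cycle of length above 2
    lies in one side and pulls back along the injective shift. *)
Lemma tree_join : is_tree T1 -> is_tree T2 -> is_tree T.
Proof.
move=> [sym1 irr1 con1 cyc1] [sym2 irr2 con2 cyc2].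
pose adjE := (adj_join_ll, adj_join_rr, adj_join_lr, adj_join_rl).
have symT : symmetric (adj T).
  move=> a b; rewrite -(splitK a) -(splitK b).
  by case: fintype.split => x; case: fintype.split => y; rewrite !adjE.
have conL a b : connect (adj T) (inL a) (inL b).
  apply: connect_homo (con1 a b) => x y; by rewrite adjE.
have conR a b : connect (adj T) (inR a) (inR b).
  apply: connect_homo (con2 a b) => x y; by rewrite adjE.
have conLR a b : connect (adj T) (inL a) (inR b).
  apply: connect_trans (conL a v) (connect_trans _ (conR w b)).
  by apply: connect1; rewrite adjE !eqxx.
split=> //.
- move=> a; rewrite -(splitK a); case: fintype.split => x; rewrite adjE.
    exact: irr1.
  exact: irr2.
- move=> a b; rewrite -(splitK a) -(splitK b).
  case: fintype.split => x; case: fintype.split => y //=.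
  by rewrite (sym_connect_sym symT).
pose S (x : 'I_(k1 + k2)) := if fintype.split x is inl _ then true else false.
have SL a : S (inL a) by rewrite /S -/(unsplit (inl _)) unsplitK.
have SR a : S (inR a) = false by rewrite /S -/(unsplit (inr _)) unsplitK.
have bridge x y : adj T x y -> S x -> ~~ S y -> x = inL v /\ y = inR w.
  rewrite -(splitK x) -(splitK y).
  case: fintype.split => a; case: fintype.split => b; rewrite /= ?SL ?SR //.
  by rewrite adjE => /andP[/eqP-> /eqP->].
move=> p pc; case: (bridge_ucycle symT bridge pc) => // [allS|allS].
- have [x xp|q pE] := @map_preimage _ _ inL p.
    move: (allP allS x xp); rewrite -(splitK x).
    by case: fintype.split => a; rewrite /= ?SR //; exists a.
  move: pc; rewrite pE size_map => /andP[pc pu]; apply: cyc1.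
  rewrite /ucycle -(map_inj_uniq (@lshift_inj _ k2)) pu andbT.
  by rewrite -(mono_cycle (adj_join_ll T1 T2 v w)).
- have [x xp|q pE] := @map_preimage _ _ inR p.
    move: (allP allS x xp); rewrite -(splitK x).
    by case: fintype.split => a; rewrite /= ?SL //; exists a.
  move: pc; rewrite pE size_map => /andP[pc pu]; apply: cyc2.
  rewrite /ucycle -(map_inj_uniq (@rshift_inj k1 _)) pu andbT.
  by rewrite -(mono_cycle (adj_join_rr T1 T2 v w)).
Qed.

End TreeJoin.

(** * Isomorphism of graphs and representatives of the classes of trees *)

Lemma gisoP k (T T' : graph k) :
  reflect (exists s : {perm 'I_k}, forall v w, adj T' (s v) (s w) = adj T v w)
          (giso T T').
Proof.
apply: (iffP existsP) => -[s sP]; exists s.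
  by move=> v w; have /forallP/(_ v)/forallP/(_ w)/eqP := sP.
by apply/forallP => v; apply/forallP => w; rewrite sP.
Qed.

Lemma giso_refl k : reflexive (@giso k).
Proof. by move=> T; apply/gisoP; exists 1%g => v w; rewrite !perm1. Qed.

Lemma giso_sym k : symmetric (@giso k).
Proof.
suff H (T T' : graph k) : giso T T' -> giso T' T.
  by move=> T T'; apply/idP/idP; exact: H.
move=> /gisoP[s sP]; apply/gisoP; exists (s^-1)%g => v w.
by rewrite -sP !permKV.
Qed.

Lemma giso_trans k : transitive (@giso k).
Proof.
move=> T2 T1 T3 /gisoP[s sP] /gisoP[t tP]; apply/gisoP; exists (s * t)%g => v w.
by rewrite !permM tP sP.
Qed.

Lemma giso_tree k (T T' : graph k) : giso T T' -> is_tree T -> is_tree T'.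
Proof.
rewrite giso_sym => /gisoP[s sP] [sym irr con cyc].
have symT' : symmetric (adj T') by move=> a b; rewrite -!sP.
split=> //.
- by move=> a; rewrite -sP.
- move=> a b; rewrite -(permK s a) -(permK s b).
  apply: connect_homo (con (s a) (s b)) => x y; by rewrite -sP !permKV.
move=> p /andP[pc pu]; rewrite -(size_map s); apply: cyc.
by rewrite /ucycle (mono_cycle sP) pc (map_inj_uniq perm_inj).
Qed.

Lemma giso_left k (T T' T'' : graph k) : giso T T' -> giso T T'' = giso T' T''.
Proof.
move=> TT'; apply/idP/idP; last exact: giso_trans.
by apply: giso_trans; rewrite giso_sym.
Qed.

(** [X] meets the class of [T] in a single tree [T0]. This collapses a sum over [X] of terms
    restricted to the trees isomorphic to [T]. *)
Lemma transversal_unique_giso k (X : {set graph k}) (T : graph k) :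
  is_transversal X (tree_classes k) (trees k) -> is_tree T ->
  exists2 T0, (T0 \in X) && giso T0 T &
    forall T', T' \in X -> giso T' T = (T' == T0).
Proof.
case/and3P => _ /fintype.subsetP XD /forallP Xun treeT.
have TD : T \in trees k by rewrite inE; apply/asboolP.
pose B := [set T' in trees k | giso T T']%SET.
have BP : B \in tree_classes k by apply/imsetP; exists T.
have := Xun B; rewrite BP => /cards1P[T0 XB].
have inB T' : T' \in X -> (T' \in B) = giso T' T.
  by move=> /XD T'D; rewrite inE T'D giso_sym.
have : T0 \in X :&: B by rewrite XB inE.
rewrite inE => /andP[T0X T0B]; exists T0; first by rewrite T0X -inB.
move=> T' T'X; rewrite -inB //.
by have /setP/(_ T') := XB; rewrite !inE T'X.
Qed.

(** * The expansion as an executable computation on edge lists *)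

(** Plain data, so that expansions and isomorphism tests can be evaluated by [vm_compute]. *)
Definition edge_list := seq (nat * nat).

Definition edge_adj (s : edge_list) (a b : nat) : bool :=
  ((a, b) \in s) || ((b, a) \in s).

Definition edges_in (k : nat) (s : edge_list) : bool :=
  all (fun e => (e.1 < k)%N && (e.2 < k)%N) s.

Definition join_edges (k1 : nat) (s1 : edge_list) (v : nat) (s2 : edge_list)
    (w : nat) : edge_list :=
  (v, k1 + w)%N :: s1 ++ [seq (k1 + e.1, k1 + e.2)%N | e <- s2].

Definition edge_degree (k : nat) (s : edge_list) (v : nat) : nat :=
  count (edge_adj s v) (iota 0 k).

(** The next vertex to be mapped is [size p]; [x] is tested as its image against all vertices
    already placed. *)
Definition extends_iso (s r : edge_list) (p : seq nat) (x : nat) : bool :=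
  [&& x \notin p, edge_adj r x x == edge_adj s (size p) (size p)
    & all (fun a => edge_adj r (nth 0%N p a) x == edge_adj s a (size p))
        (iota 0 (size p))].

(* Backtracking: the sequence [p] lists the images of the first vertices.  The
   conditional (rather than a conjunction) prunes the search when it is run by
   a call-by-value evaluator. *)
Fixpoint iso_search (k : nat) (s r : edge_list) (fuel : nat) (p : seq nat) :
    bool :=
  if fuel is fuel'.+1 then
    has (fun x => if extends_iso s r p x
                  then iso_search k s r fuel' (rcons p x) else false)
        (iota 0 k)
  else true.

Definition edge_iso (k : nat) (s r : edge_list) : bool :=
  iso_search k s r k [::].

(** For 2 <= k <= 6 these are the trees of (3), one per isomorphism class and with the very edge
    lists of [path_tree], [spider] and [double_star]. For other k the list is empty and
    [canonical_edges] returns its argument, the default of [nth]. *)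
Definition reference_trees (k : nat) : seq edge_list :=
  match k with
  | 2 | 3 => [:: chain_edges (iota 0%N k)]
  | 4 => chain_edges (iota 0%N k) ::
      [seq leg_edges 1 l | l <- [:: [:: 1; 1; 1]]%N]
  | 5 => chain_edges (iota 0%N k) ::
      [seq leg_edges 1 l | l <- [:: [:: 2; 1; 1]; [:: 1; 1; 1; 1]]%N]
  | 6 => [:: chain_edges (iota 0%N k),
             [:: (0, 1); (0, 2); (0, 3); (1, 4); (1, 5)]%N &
      [seq leg_edges 1 l | l <- [:: [:: 3; 1; 1]; [:: 2; 2; 1];
                                    [:: 2; 1; 1; 1]; [:: 1; 1; 1; 1; 1]]%N]]
  | _ => [::]
  end.

(* Replacing a tree by an isomorphic reference tree does not matter for the
   proof; it keeps the expansions of low order short and in the shape in which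
   they are stated. *)
Definition canonical_edges (k : nat) (s : edge_list) : edge_list :=
  nth s (reference_trees k) (find (edge_iso k s) (reference_trees k)).

Definition merge_terms (l : seq (nat * edge_list)) : seq (nat * edge_list) :=
  [seq (sumn [seq x.1 | x <- l & x.2 == s], s) | s <- undup (unzip2 l)].

(* [grad P] is [+ sum_h lam_h u_h / f_h]: the single vertex counts as having
   degree 1. *)
Definition root_weight (k : nat) (s : edge_list) (v : nat) : nat :=
  if k == 1%N then 1%N else edge_degree k s v.

(** The terms of the gradient of an expansion, up to the common factor: N deg(v) V_{s,v} for each
    term N W_s and each root v. *)
Definition rooted_terms (k : nat) (l : seq (nat * edge_list)) :
    seq (nat * edge_list * nat) :=
  [seq (x.1 * root_weight k x.2 v, x.2, v)%N | x <- l, v <- iota 0 k].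

(** The binomial is what the factorials in the prefactors of orders i, m - i and m + 1 leave over;
    see [expansion_coef_rec]. *)
Definition joined_terms (m : nat) (prev : seq (seq (nat * edge_list))) :
    seq (nat * edge_list) :=
  flatten [seq
    [seq ('C(m, i) * p.1.1 * q.1.1, join_edges i.+1 p.1.2 p.2 q.1.2 q.2)%N
      | p <- rooted_terms i.+1 (nth [::] prev i),
        q <- rooted_terms (m - i).+1 (nth [::] prev (m - i)%N)]
    | i <- iota 0 m.+1].

Definition canonical_terms (k : nat) (l : seq (nat * edge_list)) :
    seq (nat * edge_list) :=
  merge_terms [seq (x.1, canonical_edges k x.2) | x <- l].

(** All lower orders are kept, since the recurrence uses each of them. Entry 0, the single vertex,
    stands for P only through its gradient. *)
Fixpoint tree_expansions (m : nat) : seq (seq (nat * edge_list)) :=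
  if m is m'.+1 then
    let prev := tree_expansions m' in
    rcons prev (canonical_terms m.+1 (joined_terms m' prev))
  else [:: [:: (1, [::])]]%N.

Definition tree_expansion (m : nat) : seq (nat * edge_list) :=
  nth [::] (tree_expansions m) m.


(** * Agreement of the edge-list operations with those on graphs *)

Section EdgeLists.
Implicit Types (k m : nat) (s r : edge_list).

Lemma adj_graph_of_edges k s (v w : 'I_k) :
  adj (graph_of_edges k s) v w = edge_adj s v w.
Proof. by rewrite /adj inE. Qed.

Lemma edge_adjC s : symmetric (edge_adj s).
Proof. by move=> a b; rewrite /edge_adj orbC. Qed.

Lemma gdeg_graph_of_edges k s (v : 'I_k) :
  gdeg (graph_of_edges k s) v = edge_degree k s v.
Proof.
rewrite /gdeg /edge_degree -val_enum_ord count_map cardE size_filter.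
rewrite -enumT; apply: eq_count => w /=.
by rewrite -adj_graph_of_edges.
Qed.

Lemma edge_adj_join k1 s1 v s2 w a b : edges_in k1 s1 -> (v < k1)%N ->
  edge_adj (join_edges k1 s1 v s2 w) a b =
  if (a < k1)%N then
    if (b < k1)%N then edge_adj s1 a b else (a == v) && (b == k1 + w)%N
  else
    if (b < k1)%N then (b == v) && (a == k1 + w)%N
    else edge_adj s2 (a - k1) (b - k1).
Proof.
move=> /allP s1in vk1.
have s1F x y : ~~ ((x < k1)%N && (y < k1)%N) -> ((x, y) \in s1) = false.
  by move=> xy; apply/negP => /s1in; rewrite (negbTE xy).
have s2E x y : ((x, y) \in [seq (k1 + e.1, k1 + e.2)%N | e <- s2]) =
    [&& (k1 <= x)%N, (k1 <= y)%N & (x - k1, y - k1)%N \in s2].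
  apply/mapP/and3P => [[[c d] cd [-> ->]]|[k1x k1y xy]].
    by rewrite !leq_addr !addKn.
  by exists (x - k1, y - k1)%N => //=; rewrite !subnKC.
rewrite /edge_adj !inE !mem_cat !s2E !xpair_eqE.
have vF x : (x < k1)%N = false -> (x == v) = false.
  by move=> xk; apply/eqP => xv; rewrite xv vk1 in xk.
have wF x : (x < k1)%N -> (x == k1 + w)%N = false.
  by move=> xk; apply/eqP => xv; rewrite xv ltnNge leq_addr in xk.
case: (ltnP a k1) => ak; case: (ltnP b k1) => bk.
- by rewrite !(wF a ak, wF b bk) !andbF /= !orbF.
- rewrite (wF a ak) !(s1F a b, s1F b a) ?andbF /= ?orbF //;
  by rewrite ?[(b < _)%N]ltnNge bk ?andbF.
- rewrite (wF b bk) !(s1F a b, s1F b a) ?andbF /= ?orbF //;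
  by rewrite ?[(a < _)%N]ltnNge ak ?andbF.
rewrite !(s1F a b, s1F b a) ?[(a < _)%N]ltnNge ?ak //; last by rewrite andbF.
by rewrite !vF //; apply/negbTE; rewrite -leqNgt.
Qed.

Lemma graph_of_join_edges k1 s1 (v : 'I_k1) k2 s2 (w : 'I_k2) :
  edges_in k1 s1 ->
  graph_of_edges (k1 + k2) (join_edges k1 s1 v s2 w) =
  graph_join (graph_of_edges k1 s1) (graph_of_edges k2 s2) v w.
Proof.
move=> s1in; apply/setP => -[x y].
rewrite -/(adj _ x y) -/(adj (graph_join _ _ _ _) x y).
rewrite adj_graph_of_edges edge_adj_join // -(splitK x) -(splitK y).
have rF (b : 'I_k2) : (k1 + b < k1)%N = false by rewrite ltnNge leq_addr.
case: fintype.split => a; case: fintype.split => b /=;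
  rewrite ?ltn_ord ?rF ?adj_join_ll ?adj_join_lr ?adj_join_rl ?adj_join_rr.
- by rewrite adj_graph_of_edges.
- by rewrite eqn_add2l.
- by rewrite eqn_add2l.
by rewrite adj_graph_of_edges !addKn.
Qed.

Lemma edges_in_join k1 s1 v k2 s2 w :
  edges_in k1 s1 -> edges_in k2 s2 -> (v < k1)%N -> (w < k2)%N ->
  edges_in (k1 + k2) (join_edges k1 s1 v s2 w).
Proof.
move=> s1in s2in vk wk; rewrite /edges_in /= ltn_addr // ltn_add2l wk /=.
rewrite all_cat all_map; apply/andP; split.
  by apply: sub_all s1in => e /andP[e1 e2]; rewrite !ltn_addr.
by apply: sub_all s2in => e /andP[e1 e2]; rewrite /= !ltn_add2l e1.
Qed.

Lemma iso_searchP k s r fuel p :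
  reflect (exists q, [/\ size q = fuel, all (fun x => x < k)%N q &
     forall i, (i < fuel)%N -> extends_iso s r (p ++ take i q) (nth 0%N q i)])
    (iso_search k s r fuel p).
Proof.
elim: fuel p => [|fuel IH] p /=.
  by apply: ReflectT; exists [::].
apply: (iffP hasP) => [[x xk]|[[|x q] [//= [qs] /andP[xk qk] qP]]].
  case: ifP => // ext /IH[q [qs qk qP]]; exists (x :: q); split=> /=.
  - by rewrite qs.
  - by rewrite qk andbT; rewrite mem_iota in xk.
  by case=> [|i] ifuel; rewrite ?cats0 //= -cat_rcons; apply: qP.
exists x; first by rewrite mem_iota.
have := qP 0%N isT; rewrite /= cats0 => ->; apply/IH; exists q; split=> // i ifuel.
by rewrite cat_rcons; exact: (qP i.+1).
Qed.

(** A successful search lists the values of a map on the vertices. Each pair was tested when its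
    larger vertex was placed, and freshness of each image makes the map injective, hence a
    permutation. Conversely the values of an isomorphism form a successful run. *)
Lemma edge_isoE k s r :
  edge_iso k s r = giso (graph_of_edges k s) (graph_of_edges k r).
Proof.
apply/iso_searchP/gisoP => [[q [qs qk qP]]|[t tP]].
  have qlt (i : 'I_k) : (nth 0%N q i < k)%N.
    by apply: (allP qk); rewrite mem_nth ?qs.
  pose g (i : 'I_k) := Ordinal (qlt i).
  have take_nth i j : (j < i)%N -> nth 0%N (take i q) j = nth 0%N q j.
    by move=> ji; rewrite nth_take.
  have adjq i j : (i < k)%N -> (j < i)%N ->
      nth 0%N q j != nth 0%N q i /\
      edge_adj r (nth 0%N q j) (nth 0%N q i) = edge_adj s j i.
    move=> ik ji; have := qP i ik; rewrite /extends_iso /=.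
    have st : size (take i q) = i by rewrite size_takel ?qs // ltnW.
    rewrite st => /and3P[qn _ /allP/(_ j)]; rewrite mem_iota ji take_nth //.
    move=> /(_ isT)/eqP ->; split=> //; apply: contraNneq qn => <-.
    by rewrite -(take_nth i) // mem_nth ?st.
  have g_inj : injective g.
    move=> i j /(congr1 val) /= gij; apply/ord_inj; case: (ltngtP i j) => // ij.
      by have [] := adjq j i (ltn_ord j) ij; rewrite gij eqxx.
    by have [] := adjq i j (ltn_ord i) ij; rewrite gij eqxx.
  exists (perm g_inj) => v w; rewrite !permE !adj_graph_of_edges /=.
  case: (ltngtP v w) => vw.
  - by have [_ ->] := adjq w v (ltn_ord w) vw.
  - by rewrite edge_adjC [RHS]edge_adjC; have [_ ->] := adjq v w (ltn_ord v) vw.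
  rewrite vw; have := qP w (ltn_ord w); rewrite /extends_iso /=.
  by rewrite size_takel ?qs 1?ltnW // => /and3P[_ /eqP].
pose q := [seq val (t i) | i <- enum 'I_k].
have nthq (i : 'I_k) : nth 0%N q i = t i.
  by rewrite (nth_map i) ?nth_ord_enum // size_enum_ord.
have qs : size q = k by rewrite size_map size_enum_ord.
exists q; split=> //; first by apply/allP => _ /mapP[i _ ->]; exact: ltn_ord.
move=> i ik; pose i' := Ordinal ik; rewrite /= /extends_iso.
have st : size (take i q) = i by rewrite size_takel ?qs // ltnW.
rewrite st; apply/and3P; split.
- have : uniq q by rewrite map_inj_uniq ?enum_uniq // => x y /val_inj/perm_inj.
  rewrite -{1}(cat_take_drop i q) (drop_nth 0%N) ?qs // cat_uniq /=.
  by rewrite negb_or => /and3P[_ /andP[]].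
- rewrite (nthq i') -!(adj_graph_of_edges _ i' i').
  by rewrite -(adj_graph_of_edges r (t i') (t i')) tP.
apply/allP => j; rewrite mem_iota add0n => ji.
have jk : (j < k)%N by exact: ltn_trans ji ik.
rewrite nth_take // (nthq i') (nthq (Ordinal jk)).
by rewrite -(adj_graph_of_edges s (Ordinal jk) i') -tP adj_graph_of_edges.
Qed.

Lemma canonical_edges_giso k s :
  giso (graph_of_edges k (canonical_edges k s)) (graph_of_edges k s).
Proof.
rewrite /canonical_edges; case: (boolP (has (edge_iso k s) (reference_trees k))).
  by move=> /(nth_find s); rewrite edge_isoE giso_sym.
by move=> /hasNfind ->; rewrite nth_default // giso_refl.
Qed.

Lemma reference_trees_in k : all (edges_in k) (reference_trees k).
Proof. by move: k; do 7?case=> //. Qed.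

Lemma canonical_edges_in k s : edges_in k s -> edges_in k (canonical_edges k s).
Proof.
move=> sk; rewrite /canonical_edges.
set rs := reference_trees k; case: (ltnP (find (edge_iso k s) rs) (size rs)) => H.
  by apply: (allP (reference_trees_in k)); exact: mem_nth.
by rewrite nth_default.
Qed.

Lemma sum_merge_terms (K : pzSemiRingType) (l : seq (nat * edge_list))
    (F : edge_list -> K) :
  \sum_(x <- merge_terms l) x.1%:R * F x.2 = \sum_(x <- l) x.1%:R * F x.2.
Proof.
rewrite big_map /=.
transitivity (\sum_(s <- undup (unzip2 l)) \sum_(x <- l | x.2 == s) x.1%:R * F x.2).
  apply: eq_bigr => s _; rewrite sumnE big_map big_filter natr_sum mulr_suml.
  by apply: eq_bigr => x /eqP ->.
rewrite (exchange_big_dep xpredT) //= big_seq [RHS]big_seq.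
apply: eq_bigr => x xl.
rewrite (eq_bigl (pred1 x.2)); last by move=> s; rewrite /= eq_sym.
rewrite -big_filter filter_pred1_uniq ?undup_uniq ?mem_undup ?map_f //.
by rewrite big_seq1.
Qed.

Lemma size_tree_expansions m : size (tree_expansions m) = m.+1.
Proof. by elim: m => //= m IH; rewrite size_rcons IH. Qed.

Lemma nth_tree_expansions m i : (i <= m)%N ->
  nth [::] (tree_expansions m) i = tree_expansion i.
Proof.
elim: m => [|m IH] im; first by move: im; rewrite leqn0 => /eqP ->.
move: im; rewrite leq_eqVlt => /predU1P[-> //|im].
by rewrite [tree_expansions _]/= nth_rcons size_tree_expansions im IH.
Qed.

Lemma tree_expansionS m :
  tree_expansion m.+1 =
  canonical_terms m.+2 (joined_terms m (tree_expansions m)).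
Proof.
by rewrite /tree_expansion [tree_expansions _]/= nth_rcons size_tree_expansions
  ltnn eqxx.
Qed.

Lemma is_tree_single : is_tree (graph_of_edges 1 [::]).
Proof.
split=> [v w|v|v w|p /andP[_ pu]]; rewrite ?ord1 ?adj_graph_of_edges //.
by rewrite -(card_uniqP pu) (leq_trans (max_card _)) // card_ord.
Qed.

(** Strong induction through [tree_join]; passing to a reference tree is harmless because being a
    tree is invariant under isomorphism. *)
Lemma tree_expansion_tree m x : x \in tree_expansion m ->
  edges_in m.+1 x.2 /\ is_tree (graph_of_edges m.+1 x.2).
Proof.
elim/ltn_ind: m x => -[|m] IH x.
  by rewrite inE => /eqP ->; split=> //; exact: is_tree_single.
rewrite tree_expansionS => /mapP[s]; rewrite mem_undup => /mapP[y].
move=> /mapP[y' + ->] /= -> ->{x} /=.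
suff H : y' \in joined_terms m (tree_expansions m) ->
    edges_in m.+2 y'.2 /\ is_tree (graph_of_edges m.+2 y'.2).
  move=> /H[yin ytree]; split; first exact: canonical_edges_in.
  by apply: giso_tree ytree; rewrite giso_sym canonical_edges_giso.
move=> /flattenP[l lP]; case: (@mapP _ _ _ _ _ lP) => i.
rewrite mem_iota add0n => /= im ->.
move=> /allpairsP[[p q] [/= pr qr ->]] /=.
move: pr => /allpairsP[[x1 v] [x1P vP ->]] /=.
move: qr => /allpairsP[[x2 w] [x2P wP ->]] /=.
rewrite nth_tree_expansions //= in x1P.
rewrite nth_tree_expansions ?leq_subr //= in x2P.
have [in1 tree1] := IH i im _ x1P.
have [in2 tree2] := IH (m - i)%N (leq_ltn_trans (leq_subr _ _) (ltnSn _)) _ x2P.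
rewrite mem_iota add0n /= in vP; rewrite mem_iota add0n /= in wP.
have -> : m.+2 = (i.+1 + (m - i).+1)%N by rewrite addSn addnS subnKC.
split; first exact: edges_in_join.
rewrite (graph_of_join_edges (Ordinal vP) _ (Ordinal wP)) //; exact: tree_join.
Qed.

Lemma sum_rooted_terms (K : pzSemiRingType) k (l : seq (nat * edge_list))
    (F : edge_list -> nat -> K) :
  \sum_(p <- rooted_terms k l) p.1.1%:R * F p.1.2 p.2 =
  \sum_(x <- l) x.1%:R * \sum_(v < k) (root_weight k x.2 v)%:R * F x.2 v.
Proof.
rewrite big_allpairs_dep /=; apply: eq_bigr => x _.
rewrite -{1}(subn0 k) -/(index_iota 0 k) big_mkord mulr_sumr.
by apply: eq_bigr => v _; rewrite natrM mulrA.
Qed.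

Lemma sum_joined_terms (K : comPzRingType) m (F : edge_list -> K) :
  \sum_(x <- joined_terms m (tree_expansions m)) x.1%:R * F x.2 =
  \sum_(i < m.+1) 'C(m, i)%:R *
    \sum_(p <- rooted_terms i.+1 (tree_expansion i))
    \sum_(q <- rooted_terms (m - i).+1 (tree_expansion (m - i)))
      p.1.1%:R * (q.1.1%:R * F (join_edges i.+1 p.1.2 p.2 q.1.2 q.2)).
Proof.
rewrite big_flatten big_map -{1}(subn0 m.+1) -/(index_iota 0 m.+1) big_mkord.
apply: eq_bigr => i _; rewrite big_allpairs_dep /=.
rewrite nth_tree_expansions -1?ltnS // nth_tree_expansions ?leq_subr //.
rewrite mulr_sumr; apply: eq_bigr => p _; rewrite mulr_sumr.
by apply: eq_bigr => q _; rewrite !natrM !mulrA.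
Qed.

End EdgeLists.

Lemma sum_canonical_terms (K : pzSemiRingType) k (l : seq (nat * edge_list))
    (F : edge_list -> K) : (forall s, F (canonical_edges k s) = F s) ->
  \sum_(x <- canonical_terms k l) x.1%:R * F x.2 = \sum_(x <- l) x.1%:R * F x.2.
Proof.
by move=> FE; rewrite sum_merge_terms big_map; apply: eq_bigr => x _; rewrite FE.
Qed.

(** * The expansion of the solution, by induction on the order *)

Lemma big_ffun1 (K : nmodType) (A : finType) (F : {ffun 'I_1 -> A} -> K) :
  \sum_h F h = \sum_a F [ffun=> a].
Proof.
rewrite (reindex (fun a : A => [ffun=> a] : {ffun 'I_1 -> A})) //=.
exists (fun h => h ord0) => [a _|h _]; first by rewrite ffunE.
by apply/ffunP => x; rewrite ffunE (ord1 x).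
Qed.

(** The value at m = 0 is -1. The gradient of order m carries the factor [- expansion_coef K m], so
    this gives grad P its plus sign. *)
Definition expansion_coef (K : unitRingType) (m : nat) : K :=
  (-1) ^+ m.+1 / (2 ^+ m * m`!%:R).

Lemma expansion_coef_rec (K : numFieldType) m (i : 'I_m.+1) :
  m.+1%:R * (expansion_coef K m.+1 * 'C(m, i)%:R) =
  2^-1 * (expansion_coef K i * expansion_coef K (m - i)).
Proof.
have im : (i <= m)%N by rewrite -ltnS.
rewrite /expansion_coef factS -(bin_fact im) !natrM.
have -> : (-1) ^+ m.+2 = (-1) ^+ i.+1 * (-1) ^+ (m - i).+1 :> K.
  by rewrite -exprD addSn addnS subnKC.
have -> : 2 ^+ m.+1 = 2 * (2 ^+ i * 2 ^+ (m - i)) :> K.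
  by rewrite -exprD subnKC // exprS.
have n0 k : (0 < k)%N -> k%:R != 0 :> K by move=> k0; rewrite pnatr_eq0 -lt0n.
have e0 k : 2 ^+ k != 0 :> K by rewrite expf_neq0 // pnatr_eq0.
by field; rewrite ?e0 ?n0 ?fact_gt0 ?bin_gt0 //= nat1r pnatr_eq0.
Qed.

Section Expansion.
Variables (R : realType) (n : nat) (A : finType).
Variables (u0 : A -> R) (u : A -> 'rV[R]_n) (lam : A -> R).
Local Notation K := (cplx R).
Local Notation f := (hyp_form u0 u).
Local Notation a := (expansion_coef K).

Definition edge_weight (k : nat) (s : edge_list) (z : 'rV[K]_n) : K :=
  tree_weight u0 u lam (graph_of_edges k s) z.

(** Roots in the lists are natural numbers; the value 0 outside the vertex set makes the function
    total. *)
Definition pointed_edge_weight (k : nat) (z : 'rV[K]_n) (i : 'I_n)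
    (s : edge_list) (v : nat) : K :=
  if insub v is Some v' then pointed_weight u0 u lam (graph_of_edges k s) v' z i
  else 0.

Lemma pointed_edge_weight_ord k z i s (v : 'I_k) :
  pointed_edge_weight k z i s v =
  pointed_weight u0 u lam (graph_of_edges k s) v z i.
Proof. by rewrite /pointed_edge_weight valK. Qed.

Lemma edge_weight_canonical k s z :
  edge_weight k (canonical_edges k s) z = edge_weight k s z.
Proof.
apply: tree_weight_giso (canonical_edges_giso k s) => v w.
by rewrite !adj_graph_of_edges edge_adjC.
Qed.

Lemma pointed_edge_weight_join k1 s1 v k2 s2 w z :
  edges_in k1 s1 -> (v < k1)%N -> (w < k2)%N ->
  \sum_(i < n) pointed_edge_weight k1 z i s1 v * pointed_edge_weight k2 z i s2 w =
  edge_weight (k1 + k2) (join_edges k1 s1 v s2 w) z.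
Proof.
move=> s1in vk wk; rewrite /edge_weight.
rewrite (graph_of_join_edges (Ordinal vk) _ (Ordinal wk)) // -pointed_weight_join.
by apply: eq_bigr => i _; rewrite -!pointed_edge_weight_ord.
Qed.

Lemma rooted_terms_in m p : p \in rooted_terms m.+1 (tree_expansion m) ->
  edges_in m.+1 p.1.2 /\ (p.2 < m.+1)%N.
Proof.
move=> /allpairsP[[x v] [xP vP ->]] /=; split.
  by have [] := tree_expansion_tree xP.
by rewrite mem_iota add0n in vP.
Qed.

Definition expansion_gradient (m : nat) (z : 'rV[K]_n) (i : 'I_n) : K :=
  - a m * \sum_(p <- rooted_terms m.+1 (tree_expansion m))
            p.1.1%:R * pointed_edge_weight m.+1 z i p.1.2 p.2.

(** The candidate gradients satisfy the recurrence: expanding the products gives one term for each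
    pair of rooted trees, and joining the pairs at their roots produces exactly [joined_terms]. *)
Lemma expansion_gradient_conv m z :
  2^-1 * \sum_(i < n) \sum_(j < m.+1)
     expansion_gradient j z i * expansion_gradient (m - j) z i =
  m.+1%:R * (a m.+1 *
    \sum_(x <- tree_expansion m.+1) x.1%:R * edge_weight m.+2 x.2 z).
Proof.
rewrite tree_expansionS.
rewrite (@sum_canonical_terms _ _ _ (fun s => edge_weight m.+2 s z)); last first.
  by move=> s; exact: edge_weight_canonical.
rewrite (sum_joined_terms m (fun s => edge_weight m.+2 s z)).
rewrite exchange_big /= mulr_sumr [X in _ = _ * X]mulr_sumr [RHS]mulr_sumr.
apply: eq_bigr => j _; rewrite [X in _ = _ * X]mulrA [RHS]mulrA.
rewrite expansion_coef_rec -[RHS]mulrA; congr (_ * _).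
(* The minus signs of the two gradients cancel. *)
under eq_bigr => i _.
  rewrite /expansion_gradient mulrACA mulrNN mulr_suml; over.
rewrite -mulr_sumr; congr (_ * _).
rewrite exchange_big /=; apply: eq_big_seq => p /rooted_terms_in[pin pv].
under eq_bigr => i _ do rewrite mulr_sumr.
rewrite exchange_big /=; apply: eq_big_seq => q /rooted_terms_in[qin qv].
under eq_bigr => i _ do rewrite mulrACA.
rewrite -mulr_sumr pointed_edge_weight_join // -mulrA.
by have -> : (j.+1 + (m - j).+1 = m.+2)%N by rewrite addSn addnS subnKC // -ltnS.
Qed.

Lemma is_derive_expansion m z i : (forall h, f h z != 0) ->
  is_derive z (delta_mx 0 i)
    (fun x => a m.+1 *
       \sum_(t <- tree_expansion m.+1) t.1%:R * edge_weight m.+2 t.2 x)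
    (expansion_gradient m.+1 z i).
Proof.
move=> f0; rewrite /expansion_gradient mulNr -mulrN sum_rooted_terms -sumrN.
apply: is_derive_scale.
under eq_fun do rewrite big_seq.
rewrite big_seq; apply: is_derive_big_sum => t tl.
have [_ [tsym tirr _ _]] := tree_expansion_tree tl.
rewrite -mulrN; apply: is_derive_scale.
rewrite /edge_weight; have H := is_derive_tree_weight lam i tsym tirr f0.
apply: (is_derive_eq H).
congr (- _); apply: eq_bigr => v _; rewrite pointed_edge_weight_ord.
by rewrite gdeg_graph_of_edges.
Qed.

Lemma weight_term_single (a : A) z :
  weight_term u0 u lam (graph_of_edges 1 [::]) [ffun=> a] z = of_real (lam a).
Proof.
rewrite /weight_term big_ord_recl big_ord0 ffunE.
rewrite big_pred0 ?mulr1 // => e; rewrite adj_graph_of_edges.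
by rewrite /edge_adj !in_nil andbF.
Qed.

Lemma pointed_weight_single z i :
  pointed_edge_weight 1 z i [::] 0 =
  \sum_h of_real (lam h) * (of_real (u h 0 i) / f h z).
Proof.
rewrite (pointed_edge_weight_ord z i [::] (ord0 : 'I_1)) /pointed_weight big_ffun1.
by apply: eq_bigr => h _; rewrite ffunE weight_term_single.
Qed.

Lemma expansion_gradient0 z i :
  expansion_gradient 0 z i = \sum_h of_real (lam h) * (of_real (u h 0 i) / f h z).
Proof.
rewrite /expansion_gradient big_seq1 /= pointed_weight_single /expansion_coef.
by rewrite expr1 expr0 fact0 !mul1r !divr1 opprK !mul1r.
Qed.

Variables (U : set 'rV[K]_n) (L : A -> 'rV[K]_n -> K) (Q : nat -> 'rV[K]_n -> K).
Hypothesis openU : open U.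
Hypothesis logL : forall h, log_branch U (f h) (L h).
Hypothesis solQ : power_series_solution U (master_function lam L) Q.

Lemma solution_recurrence m z : U z ->
  m.+1%:R * Q m.+1 z =
  2^-1 * \sum_(i < n) \sum_(j < m.+1) grad (Q j) z 0 i * grad (Q (m - j)) z 0 i.
Proof. by case: solQ => _ _ H /H/(_ m). Qed.

(** The solution is known only on [U]. As [U] is open, equality there is equality near [z], which
    determines the derivatives. *)
Lemma grad_near (g g' : 'rV[K]_n -> K) z i d :
  U z -> (forall x, U x -> g x = g' x) ->
  is_derive z (delta_mx 0 i) g' d -> grad g z 0 i = d.
Proof.
move=> Uz gg' [_ <-]; rewrite mxE; apply: near_eq_derive.
by apply: filterS gg' _; exact: open_nbhs_nbhs.
Qed.

Lemma grad_solution0 z i : U z -> grad (Q 0%N) z 0 i = expansion_gradient 0 z i.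
Proof.
move=> Uz; rewrite expansion_gradient0.
apply: (@grad_near _ (master_function lam L)) => //; first by case: solQ.
apply: is_derive_big_sum => h _; apply: is_derive_scale.
by apply: log_branch_is_derive (logL h) Uz _ => //; exact: is_derive_hyp_form.
Qed.

(** The two claims are proved together: the gradients of lower order give [Q m] by the recurrence,
    and differentiating this expansion gives the gradient of order m. At m = 0 only the gradient
    formula is available. *)
Lemma solution_expansion_grad m :
  (forall z i, U z -> grad (Q m) z 0 i = expansion_gradient m z i) /\
  (forall z, U z -> (0 < m)%N -> Q m z = a m *
     \sum_(x <- tree_expansion m) x.1%:R * edge_weight m.+1 x.2 z).
Proof.
elim/ltn_ind: m => -[|m] IH.
  by split=> // z i Uz; exact: grad_solution0.
have QE z : U z -> Q m.+1 z = a m.+1 *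
    \sum_(x <- tree_expansion m.+1) x.1%:R * edge_weight m.+2 x.2 z.
  move=> Uz; have m0 : m.+1%:R != 0 :> K by rewrite pnatr_eq0.
  apply: (mulfI m0); rewrite solution_recurrence // -expansion_gradient_conv.
  congr (_ * _); apply: eq_bigr => i _; apply: eq_bigr => j _.
  have [gj _] := IH j (ltn_ord j).
  have [gmj _] := IH (m - j)%N (leq_ltn_trans (leq_subr j m) (ltnSn m)).
  exact: (congr2 *%R (gj z i Uz) (gmj z i Uz)).
split=> [z i Uz|z Uz _]; last exact: QE.
apply: (grad_near Uz QE _); apply: is_derive_expansion => h.
exact: log_branch_neq0 (logL h) Uz.
Qed.

Lemma solution_expansion m z : U z -> Q m.+1 z = a m.+1 *
  \sum_(x <- tree_expansion m.+1) x.1%:R * edge_weight m.+2 x.2 z.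
Proof. by move=> Uz; have [_ H] := solution_expansion_grad m.+1; exact: H. Qed.

End Expansion.

(** * Evaluation for 1 <= m <= 5 and the constants c_T *)

Lemma tree_expansion1E : tree_expansion 1 = [:: (1, chain_edges (iota 0 2))]%N.
Proof. by vm_compute. Qed.

Lemma tree_expansion2E : tree_expansion 2 = [:: (4, chain_edges (iota 0 3))]%N.
Proof. by vm_compute. Qed.

Lemma tree_expansion3E : tree_expansion 3 =
  [:: (16, leg_edges 1 [:: 1; 1; 1]); (24, chain_edges (iota 0 4))]%N.
Proof. by vm_compute. Qed.

Lemma tree_expansion4E : tree_expansion 4 =
  [:: (96, leg_edges 1 [:: 1; 1; 1; 1]); (384, leg_edges 1 [:: 2; 1; 1]);
      (192, chain_edges (iota 0 5))]%N.
Proof. by vm_compute. Qed.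

Lemma tree_expansion5E : tree_expansion 5 =
  [:: (768, leg_edges 1 [:: 1; 1; 1; 1; 1]); (3840, leg_edges 1 [:: 2; 1; 1; 1]);
      (1920, [:: (0, 1); (0, 2); (0, 3); (1, 4); (1, 5)]);
      (3840, leg_edges 1 [:: 2; 2; 1]); (3840, leg_edges 1 [:: 3; 1; 1]);
      (1920, chain_edges (iota 0 6))]%N.
Proof. by vm_compute. Qed.

Lemma expansion_coefE (K : numFieldType) :
  [/\ expansion_coef K 1 = 1 / 2, expansion_coef K 2 = - (1 / 8),
      expansion_coef K 3 = 1 / 48, expansion_coef K 4 = - (1 / 384)
    & expansion_coef K 5 = 1 / 3840].
Proof. by split; rewrite /expansion_coef !factS fact0 /=; field. Qed.

Definition tree_coef (R : realType) (k : nat) (T : graph k) : R :=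
  expansion_coef R k.-1 *
  \sum_(x <- tree_expansion k.-1) x.1%:R * (giso T (graph_of_edges k x.2))%:R.

Section TreeCoef.
Variable R : realType.

Lemma tree_coef_giso k (T T' : graph k) :
  giso T T' -> tree_coef R T = tree_coef R T'.
Proof.
move=> TT'; congr (_ * _); apply: eq_bigr => x _.
by rewrite (giso_left _ TT').
Qed.

(** With the executable test in place of [giso], the sum becomes a natural number that [vm_compute]
    finds; only rational arithmetic is left for [field]. *)
Lemma tree_coef_edges k s :
  tree_coef R (graph_of_edges k s) =
  expansion_coef R k.-1 *
    (sumn [seq if edge_iso k s x.2 then x.1 else 0%N | x <- tree_expansion k.-1])%:R.
Proof.
rewrite sumnE big_map natr_sum; congr (_ * _); apply: eq_bigr => x _.
by rewrite edge_isoE; case: giso; rewrite ?mulr1 ?mulr0.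
Qed.

Lemma tree_coef_eq k s l N c :
  tree_expansion k = l -> expansion_coef R k = c ->
  sumn [seq if edge_iso k.+1 s x.2 then x.1 else 0%N | x <- l] = N ->
  tree_coef R (graph_of_edges k.+1 s) = c * N%:R.
Proof. by move=> <- <- <-; exact: tree_coef_edges. Qed.

Lemma tree_coef_low_order :
  ([/\ tree_coef R (path_tree 2) = 1 / 2,
       tree_coef R (path_tree 3) = - (1 / 2),
       tree_coef R (spider [:: 1; 1; 1]%N) = 1 / 3
     & tree_coef R (path_tree 4) = 1 / 2] /\
   [/\ tree_coef R (path_tree 5) = - (1 / 2),
       tree_coef R (spider [:: 2; 1; 1]%N) = - 1
     & tree_coef R (spider [:: 1; 1; 1; 1]%N) = - (1 / 4)] /\
   [/\ tree_coef R (path_tree 6) = 1 / 2,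
       tree_coef R (spider [:: 3; 1; 1]%N) = 1,
       tree_coef R (spider [:: 2; 2; 1]%N) = 1
     & [/\ tree_coef R double_star = 1 / 2,
           tree_coef R (spider [:: 2; 1; 1; 1]%N) = 1
         & tree_coef R (spider [:: 1; 1; 1; 1; 1]%N) = 1 / 5]]).
Proof.
have [a1 a2 a3 a4 a5] := expansion_coefE R.
have E1 s N := @tree_coef_eq 1 s _ N _ tree_expansion1E a1.
have E2 s N := @tree_coef_eq 2 s _ N _ tree_expansion2E a2.
have E3 s N := @tree_coef_eq 3 s _ N _ tree_expansion3E a3.
have E4 s N := @tree_coef_eq 4 s _ N _ tree_expansion4E a4.
have E5 s N := @tree_coef_eq 5 s _ N _ tree_expansion5E a5.
split; first split.
- by apply: (etrans (E1 (chain_edges (iota 0 2))%N 1 _)); [vm_compute|field].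
- by apply: (etrans (E2 (chain_edges (iota 0 3))%N 4 _)); [vm_compute|field].
- by apply: (etrans (E3 (leg_edges 1 [:: 1; 1; 1])%N 16 _)); [vm_compute|field].
- by apply: (etrans (E3 (chain_edges (iota 0 4))%N 24 _)); [vm_compute|field].
split; first split.
- by apply: (etrans (E4 (chain_edges (iota 0 5))%N 192 _)); [vm_compute|field].
- by apply: (etrans (E4 (leg_edges 1 [:: 2; 1; 1])%N 384 _)); [vm_compute|field].
- by apply: (etrans (E4 (leg_edges 1 [:: 1; 1; 1; 1])%N 96 _)); [vm_compute|field].
split; last split.
- by apply: (etrans (E5 (chain_edges (iota 0 6))%N 1920 _)); [vm_compute|field].
- by apply: (etrans (E5 (leg_edges 1 [:: 3; 1; 1])%N 3840 _)); [vm_compute|field].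
- by apply: (etrans (E5 (leg_edges 1 [:: 2; 2; 1])%N 3840 _)); [vm_compute|field].
- pose s := [:: (0, 1); (0, 2); (0, 3); (1, 4); (1, 5)]%N.
  by apply: (etrans (E5 s 1920%N _)); [vm_compute|field].
- by apply: (etrans (E5 (leg_edges 1 [:: 2; 1; 1; 1])%N 3840 _)); [vm_compute|field].
- by apply: (etrans (E5 (leg_edges 1 [:: 1; 1; 1; 1; 1])%N 768 _)); [vm_compute|field].
Qed.

End TreeCoef.

(** * The clauses of the theorem for a given solution *)

Lemma of_real_expansion_coef (R : realType) m :
  of_real (expansion_coef R m) = expansion_coef (cplx R) m.
Proof.
by rewrite /of_real /expansion_coef rmorphM fmorphV rmorphM !rmorphXn rmorphN1
  /= !rmorph_nat.
Qed.

Lemma of_real_tree_coef (R : realType) k (T : graph k) :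
  of_real (tree_coef R T) = expansion_coef (cplx R) k.-1 *
    \sum_(x <- tree_expansion k.-1) x.1%:R * (giso T (graph_of_edges k x.2))%:R.
Proof.
rewrite -of_real_expansion_coef /of_real /tree_coef rmorphM rmorph_sum /=.
by congr (_ * _); apply: eq_bigr => x _; rewrite rmorphM /= !rmorph_nat.
Qed.

Lemma sum_ord_pair_antidiagonal (K : nmodType) m (F : nat -> nat -> K) :
  \sum_(p : 'I_m.+1 * 'I_m.+1 | (p.1 + p.2)%N == m) F p.1 p.2 =
  \sum_(i < m.+1) F i (m - i)%N.
Proof.
rewrite big_mkcond.
rewrite -(pair_bigA _ (fun i j : 'I_m.+1 => if (i + j)%N == m then F i j else 0)) /=.
apply: eq_bigr => i _; rewrite -big_mkcond /=.
have mi : (m - i < m.+1)%N by rewrite ltnS leq_subr.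
rewrite (big_pred1 (Ordinal mi)) // => j; rewrite /= -val_eqE /=.
apply/eqP/eqP => [ij|->]; first by rewrite -(addKn i j) ij.
by rewrite subnKC // -ltnS.
Qed.

Section Solution.
Variables (R : realType) (n : nat) (A : finType).
Variables (u0 : A -> R) (u : A -> 'rV[R]_n) (lam : A -> R).
Local Notation K := (cplx R).
Local Notation f := (hyp_form u0 u).

Lemma tree_weightE k (T : graph k) z :
  tree_weight u0 u lam T z = \sum_h weight_term u0 u lam T h z.
Proof. by []. Qed.

Lemma weight_path2 z :
  tree_weight u0 u lam (path_tree 2) z =
  \sum_(h : A) \sum_(k : A)
    (of_real (lam h) * of_real (lam k) * of_real (dotp (u h) (u k))) /
    (f h z * f k z).
Proof.
have -> : path_tree 2 = graph_of_edges (1 + 1)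
    (join_edges 1 [::] (ord0 : 'I_1) [::] (ord0 : 'I_1)) by [].
rewrite graph_of_join_edges // tree_weightE [LHS](@big_ffun_cat _ A 1 1) big_ffun1.
apply: eq_bigr => h _; rewrite big_ffun1; apply: eq_bigr => k _.
by rewrite (@weight_term_join _ _ _ u0 u lam 1 1) !weight_term_single !ffunE mulrA.
Qed.

Lemma weight_path3 z :
  tree_weight u0 u lam (path_tree 3) z =
  \sum_(h : A) \sum_(k : A) \sum_(j : A)
    (of_real (lam h) * of_real (lam k) * of_real (lam j) *
     of_real (dotp (u h) (u k)) * of_real (dotp (u h) (u j))) /
    (f k z * f h z ^+ 2 * f j z).
Proof.
pose dot := graph_of_edges 1 [::].
pose v : 'I_(1 + 1) := rshift 1 (ord0 : 'I_1).
pose path2 := graph_join dot dot (ord0 : 'I_1) (ord0 : 'I_1).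
have -> : path_tree 3 = graph_join path2 dot v (ord0 : 'I_1).
  rewrite /path2 -graph_of_join_edges // -graph_of_join_edges //.
  (* The two edge lists differ in the order of their entries, so the graphs are compared as sets. *)
  apply/setP => e; rewrite !inE /=; case: e => [[x xl] [y yl]] /=.
  by rewrite !xpair_eqE; do ![case: eqP => //= _].
(* The centre [h] of the formula labels vertex 1 of the path, whereas labellings are split off from
   vertex 0 on; hence the exchange of the sums over [h] and [k]. *)
rewrite exchange_big /= tree_weightE [LHS](@big_ffun_cat _ A (1 + 1) 1).
rewrite [LHS](@big_ffun_cat _ A 1 1) big_ffun1; apply: eq_bigr => k _.
rewrite big_ffun1; apply: eq_bigr => h _.
rewrite big_ffun1; apply: eq_bigr => j _.
rewrite (@weight_term_join _ _ _ u0 u lam (1 + 1) 1).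
rewrite (@weight_term_join _ _ _ u0 u lam 1 1) !weight_term_single.
rewrite ffun_catr !ffunE expr2 !invfM.
have -> : dotp (u k) (u h) = dotp (u h) (u k).
  by apply: eq_bigr => i _; rewrite mulrC.
ring.
Qed.

Variables (U : set 'rV[K]_n) (L : A -> 'rV[K]_n -> K) (Q : nat -> 'rV[K]_n -> K).
Hypothesis openU : open U.
Hypothesis logL : forall h, log_branch U (f h) (L h).
Hypothesis solQ : power_series_solution U (master_function lam L) Q.

Lemma solution_recurrence_dotp m z : U z -> (1 <= m)%N ->
  m%:R * Q m z =
  1 / 2 * \sum_(p : 'I_m * 'I_m | (p.1 + p.2)%N == m.-1)
            dotp (grad (Q p.1) z) (grad (Q p.2) z).
Proof.
case: m => // m Uz _; rewrite (solution_recurrence solQ) //= mul1r; congr (_ * _).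
pose F i j := dotp (grad (Q i) z) (grad (Q j) z).
rewrite (sum_ord_pair_antidiagonal m F).
exact: exchange_big.
Qed.

Lemma solution_tree_classes m z (X : {set graph m.+1}) : U z -> (1 <= m)%N ->
  is_transversal X (tree_classes m.+1) (trees m.+1) ->
  Q m z = \sum_(T in X) of_real (tree_coef R T) * tree_weight u0 u lam T z.
Proof.
case: m X => // m X Uz _ XP.
rewrite (solution_expansion openU logL solQ) //.
transitivity (\sum_(T in X) \sum_(x <- tree_expansion m.+1)
   expansion_coef K m.+1 * (x.1%:R * ((giso T (graph_of_edges m.+2 x.2))%:R *
     tree_weight u0 u lam T z))); last first.
  apply: eq_bigr => T _; rewrite of_real_tree_coef -mulr_sumr -[RHS]mulrA.
  by congr (_ * _); rewrite mulr_suml; apply: eq_bigr => x _; rewrite mulrA.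
rewrite exchange_big /= mulr_sumr; apply: eq_big_seq => x xP.
rewrite -!mulr_sumr; congr (_ * (_ * _)).
have [_ xtree] := tree_expansion_tree xP.
have [T0 /andP[T0X T0x] Tun] := transversal_unique_giso XP xtree.
(* Only the representative [T0] of the class of the term survives, and it has the same weight. *)
rewrite (bigD1 T0) //= T0x mul1r big1 ?addr0.
  symmetry; apply: tree_weight_giso T0x.
  have : T0 \in trees m.+2.
    by case/and3P: XP => _ /fintype.subsetP/(_ _ T0X).
  by rewrite inE => /asboolP[].
by move=> T /andP[TX TT0]; rewrite Tun // (negbTE TT0) mul0r.
Qed.

Lemma solution_low_order z : U z ->
  [/\ Q 1%N z = 1 / 2 * tree_weight u0 u lam (path_tree 2) z,
      Q 2%N z = - (1 / 2) * tree_weight u0 u lam (path_tree 3) z,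
      Q 3%N z = 1 / 3 * tree_weight u0 u lam (spider [:: 1; 1; 1]%N) z
              + 1 / 2 * tree_weight u0 u lam (path_tree 4) z,
      Q 4%N z = - (1 / 2) * tree_weight u0 u lam (path_tree 5) z
              - tree_weight u0 u lam (spider [:: 2; 1; 1]%N) z
              - 1 / 4 * tree_weight u0 u lam (spider [:: 1; 1; 1; 1]%N) z
    & Q 5%N z = 1 / 2 * tree_weight u0 u lam (path_tree 6) z
              + tree_weight u0 u lam (spider [:: 3; 1; 1]%N) z
              + tree_weight u0 u lam (spider [:: 2; 2; 1]%N) z
              + 1 / 2 * tree_weight u0 u lam double_star z
              + tree_weight u0 u lam (spider [:: 2; 1; 1; 1]%N) z
              + 1 / 5 * tree_weight u0 u lam (spider [:: 1; 1; 1; 1; 1]%N) z].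
Proof.
move=> Uz; have [a1 a2 a3 a4 a5] := expansion_coefE K.
have E m c l : expansion_coef K m.+1 = c -> tree_expansion m.+1 = l ->
    Q m.+1 z = c * \sum_(x <- l) x.1%:R * edge_weight u0 u lam m.+2 x.2 z.
  by move=> <- <-; exact: (solution_expansion openU logL solQ).
rewrite (E _ _ _ a1 tree_expansion1E) (E _ _ _ a2 tree_expansion2E).
rewrite (E _ _ _ a3 tree_expansion3E) (E _ _ _ a4 tree_expansion4E).
rewrite (E _ _ _ a5 tree_expansion5E).
rewrite !big_cons !big_nil /fst /snd /edge_weight.
(* The weights are replaced by variables, in the order of the computed expansions, so that [field]
   faces pure arithmetic; the named trees are then recognised by conversion. *)
have F1 w : 1 / 2 * (1 * w + 0) = 1 / 2 * w :> K by field.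
have F2 w : - (1 / 8) * (4 * w + 0) = - (1 / 2) * w :> K by field.
have F3 w1 w2 : 1 / 48 * (16 * w1 + (24 * w2 + 0)) =
    1 / 3 * w1 + 1 / 2 * w2 :> K.
  by field.
have F4 w1 w2 w3 : - (1 / 384) * (96 * w1 + (384 * w2 + (192 * w3 + 0))) =
    - (1 / 2) * w3 - w2 - 1 / 4 * w1 :> K.
  by field.
have F5 w1 w2 w3 w4 w5 w6 : 1 / 3840 * (768 * w1 + (3840 * w2 + (1920 * w3 +
      (3840 * w4 + (3840 * w5 + (1920 * w6 + 0)))))) =
    1 / 2 * w6 + w5 + w4 + 1 / 2 * w3 + w2 + 1 / 5 * w1 :> K.
  by field.
split.
- exact: F1.
- exact: F2.
- exact: F3.
- exact: F4.
- exact: F5.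
Qed.

End Solution.
Theorem mainTheorem4 (R : realType) :
  exists c : forall k : nat, graph k -> R,
  [/\ (forall (k : nat) (T T' : graph k), giso T T' -> c k T = c k T'),
      ([/\ c _ (path_tree 2) = 1 / 2,
          c _ (path_tree 3) = - (1 / 2),
          c _ (spider [:: 1; 1; 1]%N) = 1 / 3
        & c _ (path_tree 4) = 1 / 2] /\
       [/\ c _ (path_tree 5) = - (1 / 2),
          c _ (spider [:: 2; 1; 1]%N) = - 1
        & c _ (spider [:: 1; 1; 1; 1]%N) = - (1 / 4)] /\
       [/\ c _ (path_tree 6) = 1 / 2,
          c _ (spider [:: 3; 1; 1]%N) = 1,
          c _ (spider [:: 2; 2; 1]%N) = 1
        & [/\ c _ double_star = 1 / 2,
             c _ (spider [:: 2; 1; 1; 1]%N) = 1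
           & c _ (spider [:: 1; 1; 1; 1; 1]%N) = 1 / 5]])
    & forall (n : nat) (A : finType)
        (u0 : A -> R) (u : A -> 'rV[R]_n) (lam : A -> R)
        (hu : forall h, u h != 0) (hlam : forall h, 0 < lam h)
        (U : set 'rV[cplx R]_n) (hU : open U)
        (L : A -> 'rV[cplx R]_n -> cplx R)
        (hL : forall h, log_branch U (hyp_form u0 u h) (L h))
        (Q : nat -> 'rV[cplx R]_n -> cplx R)
        (hQ : power_series_solution U (master_function lam L) Q)
        (z : 'rV[cplx R]_n) (hz : U z),
      let f (h : A) : cplx R := hyp_form u0 u h z in
      let d (h k : A) : cplx R := of_real (dotp (u h) (u k)) in
      let l (h : A) : cplx R := of_real (lam h) in
      let W (k : nat) (T : graph k) : cplx R := tree_weight u0 u lam T z in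
      [/\ (forall m : nat, (1 <= m)%N ->
             m%:R * Q m z =
             1 / 2 * \sum_(p : 'I_m * 'I_m | (p.1 + p.2)%N == m.-1)
                        dotp (grad (Q p.1) z) (grad (Q p.2) z)),
          (forall m : nat, (1 <= m)%N ->
             forall X : {set graph m.+1},
             is_transversal X (tree_classes m.+1) (trees m.+1) ->
             Q m z = \sum_(T in X) of_real (c _ T) * W _ T),
          [/\ Q 1%N z = 1 / 2 * W _ (path_tree 2),
              Q 2%N z = - (1 / 2) * W _ (path_tree 3),
              Q 3%N z = 1 / 3 * W _ (spider [:: 1; 1; 1]%N)
                      + 1 / 2 * W _ (path_tree 4),
              Q 4%N z = - (1 / 2) * W _ (path_tree 5)
                      - W _ (spider [:: 2; 1; 1]%N)
                      - 1 / 4 * W _ (spider [:: 1; 1; 1; 1]%N)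
            & Q 5%N z = 1 / 2 * W _ (path_tree 6)
                      + W _ (spider [:: 3; 1; 1]%N)
                      + W _ (spider [:: 2; 2; 1]%N)
                      + 1 / 2 * W _ double_star
                      + W _ (spider [:: 2; 1; 1; 1]%N)
                      + 1 / 5 * W _ (spider [:: 1; 1; 1; 1; 1]%N)],
          Q 1%N z = 1 / 2 * \sum_(h : A) \sum_(k : A)
                            (l h * l k * d h k) / (f h * f k)
        & Q 2%N z = - (1 / 2) * \sum_(h : A) \sum_(k : A) \sum_(j : A)
                            (l h * l k * l j * d h k * d h j)
                            / (f k * f h ^+ 2 * f j)]].
Proof.
exists (@tree_coef R); split; [exact: tree_coef_giso|exact: tree_coef_low_order|].
move=> n A u0 u lam hu hlam U hU L hL Q hQ z hz f d l W.
have low := solution_low_order hU hL hQ hz.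
split=> //.
- by move=> m m1; exact: (solution_recurrence_dotp hQ hz m1).
- by move=> m m1 X; exact: (solution_tree_classes hU hL hQ hz m1).
- by have [-> _ _ _ _] := low; rewrite weight_path2.
by have [_ -> _ _ _] := low; rewrite weight_path3.
Qed.
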